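(* (1) Let $A$ be an $n$-LNakayama algebra with Dyck path $D$ (of semilength $n-1$). Then $A$ has global dimension at most $2$ and satisfies the restricted Gorenstein condition if and only if $D$ is a bounce path and every $1$-hill of $D$ either starts at $(0,0)$ or ends at $(n-1,n-1)$. (2) Let $A$ be an $n$-CNakayama algebra with $n$-periodic Dyck path $D$. Then $A$ has global dimension at most $2$ and satisfies the restricted Gorenstein condition if and only if $D$ is a bounce path and has no $1$-hills.
   Context: Fix a field $\mathbb{F}$. An $n$-LNakayama (resp. $n$-CNakayama) algebra is $A=\mathbb{F}Q/I$ with $Q$ the linear quiver $0\to\cdots\to n-1$ (resp. the cyclic quiver $0\to\cdots\to n-1\to0$) and $I$ admissible ($J^m\subseteq I\subseteq J^2$, $m\ge2$, $J$ the arrow ideal). Kupisch series $c_i=\dim_{\mathbb{F}} e_iA$ (for CNakayama extended $n$-periodically). A simple right (resp. left) $A$-module $S$ is $k$-regular if $\operatorname{pd}(S)=k$, $\operatorname{Ext}^i_A(S,A)=0$ for $0\le i<k$ and $\dim_{\mathbb{F}}\operatorname{Ext}^k_A(S,A)=1$, with $A$ regarded as a right (resp. left) module. An algebra of finite global dimension $k$ satisfies the restricted Gorenstein condition if $k=0$ or every simple left and every simple right module of projective dimension $k$ is $k$-regular. Lattice paths use horizontal steps $(x,y)\to(x,y+1)$ and vertical steps $(x,y)\to(x+1,y)$. Dyck path of semilength $N$: from $(0,0)$ to $(N,N)$ in $y\ge x$, area sequence $c_k=h_k-k+1$ with $h_k$ the largest $y$ with $(k,y)$ on the path; the Dyck path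 of an $n$-LNakayama algebra has semilength $n-1$ and area sequence its Kupisch series. An $n$-periodic Dyck path is a bi-infinite path invariant under translation by $(n,n)$ whose unique vertical step from $x=k$ to $x=k+1$ has $y$-coordinate $h_k\ge k+1$, with area sequence $c_k=h_k-k+1$; that of an $n$-CNakayama algebra has area sequence its Kupisch series. A valley at $(x,y)$ is a vertical step ending at $(x,y)$ immediately followed by a horizontal step. A (periodic) Dyck path is a bounce path if all its valleys lie on the line $y=x$. A $1$-hill at position $q$ is the pair of steps $(q,q)\to(q,q+1)\to(q+1,q+1)$. *)

(* Defs.v *)
From HB Require Import structures.
From mathcomp Require Import all_boot all_order all_algebra all_field.
From mathcomp Require Import finmap monalg.

Set Implicit Arguments.
Unset Strict Implicit.
Unset Printing Implicit Defensive.

Import GRing.Theory.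
Local Open Scope ring_scope.

Record quiver := Quiver {
  vertex : finType;
  arrow : finType;
  qsrc : arrow -> vertex;
  qtgt : arrow -> vertex }.

Section Paths.
Variable Q : quiver.

Fixpoint chain (v : vertex Q) (s : seq (arrow Q)) : bool :=
  if s is a :: s' then (qsrc a == v) && chain (qtgt a) s' else true.

(* A path is a start vertex together with a composable word of arrows; the
   empty word gives the trivial path at that vertex. *)
Record qpath := QPath {
  qpath_val : vertex Q * seq (arrow Q);
  _ : chain qpath_val.1 qpath_val.2 }.

HB.instance Definition _ := [isSub for qpath_val].
HB.instance Definition _ := [Choice of qpath by <:].

Definition pstart (p : qpath) : vertex Q := (val p).1.
Definition pword (p : qpath) : seq (arrow Q) := (val p).2.
Definition pend (p : qpath) : vertex Q := last (pstart p) (map (@qtgt Q) (pword p)).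

Lemma chain_cat v s1 s2 :
  chain v (s1 ++ s2) = chain v s1 && chain (last v (map (@qtgt Q) s1)) s2.
Proof. by elim: s1 v => //= a s1 IHs v; rewrite IHs andbA. Qed.

Definition ptriv (v : vertex Q) : qpath := @QPath (v, [::]) isT.

Lemma parr_subproof (a : arrow Q) : chain (qsrc a) [:: a].
Proof. by rewrite /= eqxx. Qed.
Definition parr (a : arrow Q) : qpath := @QPath (qsrc a, [:: a]) (parr_subproof a).

(* Composition is read from left to right: first p, then q. *)
Definition pcomp (p q : qpath) : option qpath :=
  if pend p == pstart q then insub (pstart p, pword p ++ pword q) else None.

Variant pcomp_spec (p q : qpath) : option qpath -> Prop :=
  | PcompSome r of pend p = pstart q & pstart r = pstart p & pend r = pend q
      & pword r = pword p ++ pword q : pcomp_spec p q (Some r)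
  | PcompNone of pend p != pstart q : pcomp_spec p q None.

Lemma pcompP p q : pcomp_spec p q (pcomp p q).
Proof.
rewrite /pcomp; case: eqP => [e|/eqP]; last exact: PcompNone.
case: insubP => [r _ er|] /=.
  have s_r : pstart r = pstart p by rewrite /pstart er.
  have w_r : pword r = pword p ++ pword q by rewrite /pword er.
  apply: PcompSome => //; rewrite /pend s_r w_r map_cat last_cat.
  by rewrite -/(pend p) e.
rewrite chain_cat; case: p q e => [[v s] /= ps] [[w t] /= qt] e.
by rewrite /pstart /pword /= ps /=; move: e; rewrite /pend /= => ->; rewrite qt.
Qed.

Lemma qpath_inj p q : pstart p = pstart q -> pword p = pword q -> p = q.
Proof.
move=> e1 e2; apply: val_inj; move: e1 e2; rewrite /pstart /pword.
by case: (val p) (val q) => [? ?] [? ?] /= -> ->.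
Qed.

Lemma pcompA p q r :
  obind (fun x => pcomp x r) (pcomp p q) = obind (pcomp p) (pcomp q r).
Proof.
case: (pcompP p q) => [x e1 s1 t1 w1|n1]; case: (pcompP q r) => [y e2 s2 t2 w2|n2] //=.
- case: (pcompP x r) => [z e3 s3 t3 w3|]; last by rewrite t1 e2 eqxx.
  case: (pcompP p y) => [z' e4 s4 t4 w4|]; last by rewrite s2 e1 eqxx.
  by congr Some; apply: qpath_inj; rewrite ?s3 ?s4 // w3 w4 w1 w2 catA.
- by case: (pcompP x r) => // z; rewrite t1 => e; rewrite e eqxx in n2.
- by case: (pcompP p y) => // z; rewrite s2 => e; rewrite e eqxx in n1.
Qed.

Lemma ptriv_comp v p : pcomp (ptriv v) p = if v == pstart p then Some p else None.
Proof.
case: pcompP => [r e s t w|/negPf->//].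
by rewrite -e eqxx; congr Some; apply: qpath_inj; rewrite ?s.
Qed.

Lemma comp_ptriv v p : pcomp p (ptriv v) = if pend p == v then Some p else None.
Proof.
case: pcompP => [r e s t w|/negPf->//].
by rewrite e eqxx; congr Some; apply: qpath_inj => //; rewrite w cats0.
Qed.
End Paths.

Section PathAlgebra.
Variables (F : fieldType) (Q : quiver).

(* The path algebra: finitely supported functions on the set of paths. *)
Definition pathalg : Type := {malg F[qpath Q]}.
HB.instance Definition _ := GRing.Lmodule.on pathalg.

Implicit Types (x y z : pathalg) (p q r : qpath Q).

(* The key only blocks unfolding during unification. *)
Fact pathalg_key : unit. Proof. exact: tt. Qed.

Definition pamono : F -> qpath Q -> pathalg :=
  locked_with pathalg_key (fun c p => << c *g p >>).

Lemma pamonoE c p : pamono c p = << c *g p >>.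
Proof. by rewrite /pamono unlock. Qed.

Definition pabasis p : pathalg := pamono 1 p.

Definition pcell (o : option (qpath Q)) (c : F) : pathalg :=
  if o is Some r then pamono c r else 0.

Definition pamul_def x y : pathalg :=
  \sum_(p <- msupp x) \sum_(q <- msupp y) pcell (pcomp p q) (x@_p * y@_q).
Definition pamul := locked_with pathalg_key pamul_def.

Lemma pamulE x y : pamul x y =
  \sum_(p <- msupp x) \sum_(q <- msupp y) pcell (pcomp p q) (x@_p * y@_q).
Proof. by rewrite /pamul unlock. Qed.

Definition paone : pathalg := \sum_v pabasis (ptriv v).

Lemma pcell0 o : pcell o 0 = 0.
Proof. by case: o => //= r; rewrite pamonoE monalgU0. Qed.

Lemma pcellD o c d : pcell o (c + d) = pcell o c + pcell o d.
Proof. by case: o => /= [r|]; rewrite ?addr0 // !pamonoE monalgUD. Qed.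

Lemma pamulw (d1 d2 : {fset qpath Q}) x y :
  (msupp x `<=` d1)%fset -> (msupp y `<=` d2)%fset ->
  pamul x y = \sum_(p <- d1) \sum_(q <- d2) pcell (pcomp p q) (x@_p * y@_q).
Proof.
move=> le1 le2; rewrite pamulE (big_fset_incl _ le1) /=.
  apply/eq_bigr=> p _; apply/big_fset_incl => // k _ /mcoeff_outdom ->.
  by rewrite mulr0 pcell0.
move=> k _ /mcoeff_outdom xk; rewrite big1 // => k' _.
by rewrite xk mul0r pcell0.
Qed.

Lemma pamulDl : left_distributive pamul +%R.
Proof.
move=> x y z.
rewrite (pamulw (fsubsetUl (msupp x) (msupp y)) (fsubset_refl _)).
rewrite (pamulw (fsubsetUr (msupp x) (msupp y)) (fsubset_refl _)).
rewrite (pamulw (msuppD_le _ _) (fsubset_refl _)) -big_split /=.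
apply/eq_bigr=> p _; rewrite -big_split /=; apply/eq_bigr=> q _.
by rewrite mcoeffD mulrDl pcellD.
Qed.

Lemma pamulDr : right_distributive pamul +%R.
Proof.
move=> z x y.
rewrite (pamulw (fsubset_refl _) (fsubsetUl (msupp x) (msupp y))).
rewrite (pamulw (fsubset_refl _) (fsubsetUr (msupp x) (msupp y))).
rewrite (pamulw (fsubset_refl _) (msuppD_le _ _)) -big_split /=.
apply/eq_bigr=> p _; rewrite -big_split /=; apply/eq_bigr=> q _.
by rewrite mcoeffD mulrDr pcellD.
Qed.

Lemma pamul0 : right_zero 0 pamul.
Proof. by move=> x; rewrite pamulE big1 // => p _; rewrite msupp0 big_seq_fset0. Qed.

Lemma pa0mul : left_zero 0 pamul.
Proof. by move=> x; rewrite pamulE msupp0 big_seq_fset0. Qed.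

Lemma pamulUU c d p q :
  pamul (pamono c p) (pamono d q) = pcell (pcomp p q) (c * d).
Proof. by rewrite !pamonoE (pamulw msuppU_le msuppU_le) !big_seq_fset1 !mcoeffUU. Qed.

Lemma pathalg_ind (K : pathalg -> Prop) :
  K 0 -> (forall x y, K x -> K y -> K (x + y)) ->
  (forall c p, K (pamono c p)) -> forall x, K x.
Proof. 
move=> K0 KD KU x; rewrite [x]monalgE; apply: big_ind => // p _.
by rewrite -pamonoE.
 Qed.

Lemma pamul_cellU c d o q :
  pamul (pcell o c) (pamono d q) = pcell (obind (fun p => pcomp p q) o) (c * d).
Proof. by case: o => [p|]; [exact: pamulUU | exact: pa0mul]. Qed.

Lemma pamul_Ucell c d p o :
  pamul (pamono c p) (pcell o d) = pcell (obind (pcomp p) o) (c * d).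
Proof. by case: o => [q|]; [exact: pamulUU | exact: pamul0]. Qed.

Lemma pamulA : associative pamul.
Proof.
move=> x y z; elim/pathalg_ind: z => [|z z' IH IH'|e r].
- by rewrite !pamul0.
- by rewrite !pamulDr IH IH'.
elim/pathalg_ind: y => [|y y' IH IH'|d q].
- by rewrite pa0mul (pamul0 x) pa0mul.
- by rewrite pamulDl (pamulDr x) (pamulDr x) pamulDl IH IH'.
elim/pathalg_ind: x => [|x x' IH IH'|c p].
- by rewrite !pa0mul.
- by rewrite (pamulDl x) (pamulDl x x' (pamono d q)) pamulDl IH IH'.
rewrite (pamulUU d e q r) (pamulUU c d p q).
by rewrite (pamul_Ucell c) (pamul_cellU (c * d)) pcompA mulrA.
Qed.

Lemma pa1mul : left_id paone pamul.
Proof.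
elim/pathalg_ind => [|x y IH IH'|c p]; first exact: pamul0.
  by rewrite pamulDr IH IH'.
rewrite (big_morph (pamul^~ _) (fun _ _ => pamulDl _ _ _) (pa0mul _)).
rewrite (bigD1 (pstart p)) //= (pamulUU 1 c) ptriv_comp eqxx mul1r.
by rewrite big1 ?addr0 // => v /negPf nv; rewrite (pamulUU 1 c) ptriv_comp nv.
Qed.

Lemma pamul1 : right_id paone pamul.
Proof.
elim/pathalg_ind => [|x y IH IH'|c p]; first exact: pa0mul.
  by rewrite pamulDl IH IH'.
rewrite (big_morph (pamul _) (fun _ _ => pamulDr _ _ _) (pamul0 _)).
rewrite (bigD1 (pend p)) //= (pamulUU c 1) comp_ptriv eqxx mulr1.
rewrite big1 ?addr0 // => v nv.
by rewrite (pamulUU c 1) comp_ptriv eq_sym (negPf nv).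
Qed.

HB.instance Definition _ := GRing.Zmodule_isPzRing.Build pathalg
  pamulA pa1mul pamul1 pamulDl pamulDr.
End PathAlgebra.

Section Ideals.
Variable R : pzRingType.

Definition ideal (I : R -> Prop) : Prop :=
  [/\ I 0, forall x y, I x -> I y -> I (x - y)
    & forall a x b, I x -> I (a * x * b)].

Definition ideal_gen (S : R -> Prop) (x : R) : Prop :=
  forall I, ideal I -> (forall y, S y -> I y) -> I x.

Definition ideal_mul (I K : R -> Prop) : R -> Prop :=
  ideal_gen (fun x => exists a b, [/\ I a, K b & x = a * b]).

Fixpoint ideal_exp (I : R -> Prop) (m : nat) : R -> Prop :=
  if m is m'.+1 then ideal_mul (ideal_exp I m') I else fun=> True.
End Ideals.

Section BoundQuiver.
Variables (F : fieldType) (Q : quiver).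

Definition arrow_ideal : pathalg F Q -> Prop :=
  ideal_gen (fun x => exists a : arrow Q, x = pabasis F (parr a)).

Definition admissible (I : pathalg F Q -> Prop) : Prop :=
  exists m, [/\ (2 <= m)%N,
    forall x, ideal_exp arrow_ideal m x -> I x &
    forall x, I x -> ideal_exp arrow_ideal 2 x].

(* A presentation of A as FQ/I: a surjective algebra morphism from FQ onto A
   whose kernel I is admissible. Finite-dimensionality of A (falgType) is no
   restriction, since I contains a power of the arrow ideal. *)
Record bound_quiver_algebra (A : falgType F) := BoundQuiverAlgebra {
  bq_map :> {linear pathalg F Q -> A};
  bq_mul : monoid_morphism bq_map;
  bq_surj : forall a : A, exists x, bq_map x = a;
  bq_adm : admissible (fun x => bq_map x = 0) }.

Definition bq_idem (A : falgType F) (pi : bound_quiver_algebra A)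
  (v : vertex Q) : A := pi (pabasis F (ptriv v)).

Definition kupisch (A : falgType F) (pi : bound_quiver_algebra A)
  (v : vertex Q) : nat := \dim (<[bq_idem pi v]> * {:A})%VS.
End BoundQuiver.

Lemma linear_tgt_subproof n (a : 'I_n.-1) : (a.+1 < n)%N.
Proof. by rewrite -ltn_predRL. Qed.

Definition linear_quiver (n : nat) : quiver :=
  @Quiver 'I_n 'I_n.-1 (widen_ord (leq_pred n))
    (fun a => Ordinal (linear_tgt_subproof a)).

Definition cyclic_quiver (n : nat) : quiver :=
  @Quiver 'I_n 'I_n id (@ordS n).

Definition LNakayama (F : fieldType) (n : nat) (A : falgType F) : Type :=
  bound_quiver_algebra (linear_quiver n) A.
Definition CNakayama (F : fieldType) (n : nat) (A : falgType F) : Type :=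
  bound_quiver_algebra (cyclic_quiver n) A.

(* Right A-modules are left modules over the converse ring A^c, which is again
   an F-algebra for the same scalar multiplication. *)
Section ConverseAlgebra.
Variables (F : fieldType) (A : algType F).
HB.instance Definition _ := GRing.Zmodule_isLmodule.Build F A^c
  (@scalerA F A) (@scale1r F A) (@scalerDr F A) (@scalerDl F A).
Fact converse_scalerAl (c : F) (u v : A^c) : c *: (u * v) = (c *: u) * v.
Proof. exact: (@scalerAr F A). Qed.
HB.instance Definition _ := GRing.Lmodule_isLalgebra.Build F A^c converse_scalerAl.
Fact converse_scalerAr (c : F) (u v : A^c) : c *: (u * v) = u * (c *: v).
Proof. exact: (@scalerAl F A). Qed.
HB.instance Definition _ := GRing.Lalgebra_isAlgebra.Build F A^c converse_scalerAr.
End ConverseAlgebra.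

Section Homology.
Variable R : pzRingType.

Definition simple_module (S : lmodType R) : Prop :=
  (exists x : S, x <> 0) /\
  forall U : S -> Prop,
    U 0 -> (forall a x y, U x -> U y -> U (a *: x + y)) ->
    (forall x, U x -> x = 0) \/ (forall x, U x).

Definition projective (P : lmodType R) : Prop :=
  forall (M N : lmodType R) (g : {linear M -> N}) (f : {linear P -> N}),
    (forall y, exists x, g x = y) ->
    exists h : {linear P -> M}, forall x, g (h x) = f x.

Record proj_resolution (M : lmodType R) := ProjResolution {
  res_mod :> nat -> lmodType R;
  res_d : forall i, {linear res_mod i.+1 -> res_mod i};
  res_aug : {linear res_mod 0 -> M};
  res_proj : forall i, projective (res_mod i);
  res_surj : forall y, exists x, res_aug x = y;
  res_exact0 : forall x, res_aug x = 0 <-> exists y, x = res_d 0 y;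
  res_exactS : forall i x, res_d i x = 0 <-> exists y, x = res_d i.+1 y }.

Definition pd_le (M : lmodType R) (k : nat) : Prop :=
  exists P : proj_resolution M, forall i, (k < i)%N -> forall x : P i, x = 0.

Definition pd_eq (M : lmodType R) (k : nat) : Prop :=
  pd_le M k /\ forall j, pd_le M j -> (k <= j)%N.

Variables (M N : lmodType R) (P : proj_resolution M).

Definition cocycle (i : nat) (f : P i -> N) : Prop :=
  forall x, f (res_d P i x) = 0.

Definition coboundary (i : nat) : (P i -> N) -> Prop :=
  match i with
  | 0 => fun f => forall x, f x = 0
  | j.+1 => fun f => exists g : {linear P j -> N}, forall x, f x = g (res_d P j x)
  end.
End Homology.

Section Gorenstein.
Variable F : fieldType.

(* dim_F Ext^i_B(M, N) = d, where Ext^i_B(M, N) is the i-th cohomology of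
   Hom_B(P, N) for a projective resolution P of M (it does not depend on P):
   the classes of the cocycles z_j form an F-basis of cocycles modulo
   coboundaries. A scalar c acts on N as c%:A. *)
Definition ext_dim (B : algType F) (M N : lmodType B) (i d : nat) : Prop :=
  exists (P : proj_resolution M) (z : 'I_d -> {linear P i -> N}),
    (forall j, cocycle (z j)) /\
    forall f : {linear P i -> N}, cocycle f ->
      exists! c : {ffun 'I_d -> F},
        coboundary (fun x : P i => f x - \sum_j (c j)%:A *: z j x).

Definition k_regular (B : algType F) (S : lmodType B) (k : nat) : Prop :=
  [/\ pd_eq S k,
      forall i, (i < k)%N -> ext_dim S (B^o : lmodType B) i 0
    & ext_dim S (B^o : lmodType B) k 1].

Definition gldim_le (A : algType F) (k : nat) : Prop :=
  forall M : lmodType A^c, pd_le M k.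

Definition gldim_eq (A : algType F) (k : nat) : Prop :=
  gldim_le A k /\ forall j, gldim_le A j -> (k <= j)%N.

Definition restricted_Gorenstein (A : algType F) : Prop :=
  exists k, gldim_eq A k /\
    (k = 0%N \/
     (forall S : lmodType A, simple_module S -> pd_eq S k -> k_regular S k) /\
     (forall S : lmodType A^c, simple_module S -> pd_eq S k -> k_regular S k)).
End Gorenstein.

Section LatticePaths.

Definition point : Type := (int * int)%type.

Definition step : rel point :=
  [rel z w : point | (w == (z.1, z.2 + 1)) || (w == (z.1 + 1, z.2))].

(* In the next three definitions, tri a b c says that the path visits the
   points a, b, c consecutively. *)
Definition valley (tri : point -> point -> point -> Prop) (x y : int) : Prop :=
  tri (x - 1, y) (x, y) (x, y + 1).

Definition bounce (tri : point -> point -> point -> Prop) : Prop :=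
  forall x y, valley tri x y -> y = x.

Definition hill1 (tri : point -> point -> point -> Prop) (q : int) : Prop :=
  tri (q, q) (q, q + 1) (q + 1, q + 1).

Definition dyck_path (N : nat) (D : seq point) : Prop :=
  exists s : seq point, [/\ D = (0, 0) :: s, path step (0, 0) s,
                last (0, 0) s = (N%:Z, N%:Z)
              & forall z : point, z \in D -> z.1 <= z.2].

Definition dyck_area (D : seq point) (k c : int) : Prop :=
  exists h, [/\ (k, h) \in D, forall y, (k, y) \in D -> y <= h & c = h - k + 1].

Definition dyck_tri (D : seq point) (a b c : point) : Prop :=
  infix [:: a; b; c] D.

Definition bi_vertical (D : int -> point) (k y : int) : Prop :=
  exists t, D t = (k, y) /\ D (t + 1) = (k + 1, y).

Definition periodic_dyck_path (n : nat) (D : int -> point) : Prop :=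
  [/\ forall t, step (D t) (D (t + 1)),
      forall x y, (exists t, D t = (x, y)) <->
                  (exists t, D t = (x + n%:Z, y + n%:Z))
    & forall k, exists h, unique (bi_vertical D k) h /\ k + 1 <= h].

Definition periodic_area (D : int -> point) (k c : int) : Prop :=
  exists h, bi_vertical D k h /\ c = h - k + 1.

Definition bi_tri (D : int -> point) (a b c : point) : Prop :=
  exists t, [/\ D t = a, D (t + 1) = b & D (t + 2) = c].
End LatticePaths.

(* Main.v *)
Require Import Defs.
From mathcomp Require Import all_boot all_order all_algebra all_field.
From HB Require Import structures.
From mathcomp Require Import boolp finmap monalg zify.
From mathcomp Require classical_sets.

Set Implicit Arguments.
Unset Strict Implicit.
Unset Printing Implicit Defensive.

Import Order.TTheory GRing.Theory Num.Theory.
Local Open Scope ring_scope.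

(** Let a be the sum of the arrows and e_j the vertex idempotents, so that the
    nonzero paths a^l e_j form a basis of A, and let c be the Kupisch series.
    The simple S_j has a minimal resolution by the e_iA beginning with the
    vertices j, j+1, j+c_j. Hence pd S_j >= 2 iff c_{j+1} >= c_j > 1, and if A has
    global dimension 2 and Ext^2(S_j, A) is one-dimensional, then the map into
    the third term must hit the arrow ending at j+c_j, which forces c_j = 2; this
    is the bounce condition, and pd S_j <= 2 then excludes c_j = c_{j+1} = 2 with
    c_{j+2} >= 2, i.e. inner 1-hills. Conversely, these conditions say that A is
    presented by zero relations of length 2, no two of which overlap. Over such an
    algebra a module is projective as soon as an element killed by an arrow is a
    multiple of the preceding arrow in a relation (or zero); second syzygies have
    this property, so the global dimension is at most 2, and the Ext groups of the
    simple left and right modules are read off from their explicit resolutions. *)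

(** * Resolutions and syzygies *)

(** Projective dimension and Ext are stated through some unspecified resolution. Lower bounds
    therefore come from comparing that resolution with an explicit one, and only the few
    consequences needed are extracted, element by element. Modules are arbitrary, possibly
    infinite-dimensional, and the bound on the global dimension uses no decomposition into
    indecomposables: lifts are built from F-linear sections and made compatible with the arrows by a
    recursion that stops because a is nilpotent. The single nilpotent element a also replaces a
    grading on A: whether p(a) annihilates an element is decided coefficient by coefficient. The
    ring is kept abstract, with a successor permutation of its vertices, so that one argument covers
    both quivers and, through the converse ring, modules on both sides. *)

Section Kernel.
Variables (R : pzRingType) (U V : lmodType R) (d : {linear U -> V}).

Definition ker_pred : {pred U} := fun x => d x == 0.

Fact ker_submod_closed : submod_closed ker_pred.
Proof.
split=> [|c x y /eqP dx /eqP dy]; first by apply/eqP; rewrite linear0.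
by apply/eqP; rewrite linearP dx dy scaler0 addr0.
Qed.
HB.instance Definition _ :=
  GRing.isSubmodClosed.Build R U ker_pred ker_submod_closed.

(** Kernels have to be modules in their own right: they serve below as pullbacks, as the modules R
    eps and as syzygies. *)
Record ker := Ker { ker_val : U; ker_valP : ker_val \in ker_pred }.
HB.instance Definition _ := [isSub for ker_val].
HB.instance Definition _ := [Choice of ker by <:].
HB.instance Definition _ := [SubChoice_isSubLmodule of ker by <:].

Fact ker_val_linear : linear ker_val.
Proof. by move=> c x y; rewrite -[RHS]/(c *: val x + val y) -linearP. Qed.
HB.instance Definition _ := GRing.isLinear.Build R ker U _ ker_val ker_val_linear.

Lemma ker_val_eq0 x : d (ker_val x) = 0.
Proof. exact/eqP/ker_valP. Qed.
End Kernel.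

Section Lifting.
Variable R : pzRingType.
Implicit Types P U V : lmodType R.

(* The lift is a section of the pullback of d along f, followed by the
   projection to U. *)
Lemma projective_lift P U V (d : {linear U -> V}) (f : {linear P -> V}) :
  projective P -> (forall x, exists z, d z = f x) ->
  exists h : {linear P -> U}, forall x, d (h x) = f x.
Proof.
move=> projP fd.
have phi_lin : linear (fun z : P * U => f z.1 - d z.2).
  by move=> c x y; rewrite /= (linearP f) (linearP d) opprD scalerBr addrACA.
pose phi : {linear _ -> _} :=
  HB.pack (fun z : P * U => f z.1 - d z.2) (GRing.isLinear.Build _ _ _ _ _ phi_lin).
have fst_lin : linear (fun z : ker phi => (ker_val z).1).
  by move=> c x y; rewrite linearP.
pose p1 : {linear ker phi -> P} := HB.pack (fun z : ker phi => (ker_val z).1)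
  (GRing.isLinear.Build _ _ _ _ _ fst_lin).
have snd_lin : linear (fun z : ker phi => (ker_val z).2).
  by move=> c x y; rewrite linearP.
pose p2 : {linear ker phi -> U} := HB.pack (fun z : ker phi => (ker_val z).2)
  (GRing.isLinear.Build _ _ _ _ _ snd_lin).
have p1_surj y : exists x, p1 x = y.
  have [z dz] := fd y.
  have yz : (y, z) \in ker_pred phi by apply/eqP; rewrite /= dz subrr.
  by exists (Ker yz).
have [s sP] := projP _ _ p1 idfun p1_surj.
exists (p2 \o s) => x /=.
have /eqP := ker_val_eq0 (s x); rewrite /= subr_eq0 => /eqP <-.
by congr (f _); exact: sP.
Qed.
End Lifting.

(** * Comparison of an arbitrary resolution with an explicit one *)

Section Comparison.
Variables (R : pzRingType) (M Q0 Q1 Q2 : lmodType R) (P : proj_resolution M).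
Variables (aug : {linear Q0 -> M}) (d0 : {linear Q1 -> Q0}) (d1 : {linear Q2 -> Q1}).
Hypotheses (projQ0 : projective Q0) (projQ1 : projective Q1).
Hypotheses (aug_surj : forall y, exists x, aug x = y)
  (exact0 : forall x, aug x = 0 <-> exists y, x = d0 y)
  (exact1 : forall x, d0 x = 0 <-> exists y, x = d1 y).

Let aug_d0 x : aug (d0 x) = 0. Proof. by apply/exact0; exists x. Qed.
Let d0_d1 x : d0 (d1 x) = 0. Proof. by apply/exact1; exists x. Qed.
Let augP_d x : res_aug P (res_d P 0 x) = 0. Proof. by apply/res_exact0; exists x. Qed.
Let dP_d i x : res_d P i (res_d P i.+1 x) = 0.
Proof. by apply/res_exactS; exists x. Qed.

(** Both [phi0] and [psi0] lift the identity of M, so their composite on Q0 is homotopic to the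
    identity; [h0] is the first term of the homotopy. *)
Lemma comparison0 : exists (phi0 : {linear Q0 -> P 0}) (psi0 : {linear P 0 -> Q0})
    (psi1 : {linear P 1 -> Q1}) (h0 : {linear Q0 -> Q1}),
  [/\ forall x, res_aug P (phi0 x) = aug x,
      forall x, aug (psi0 x) = res_aug P x,
      forall x, d0 (psi1 x) = psi0 (res_d P 0 x)
    & forall x, d0 (h0 x) = psi0 (phi0 x) - x].
Proof.
have [phi0 phi0P] := projective_lift (d := res_aug P) (f := aug) projQ0
  (fun x => res_surj P (aug x)).
have [psi0 psi0P] := projective_lift (d := aug) (f := res_aug P) (@res_proj _ _ P 0)
  (fun x => aug_surj (res_aug P x)).
have [|psi1 psi1P] :=
  projective_lift (d := d0) (f := psi0 \o res_d P 0) (@res_proj _ _ P 1).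
  move=> x /=; have /exact0 [z ->] : aug (psi0 (res_d P 0 x)) = 0.
    by rewrite psi0P augP_d.
  by exists z.
have [|h0 h0P] :=
  projective_lift (d := d0) (f := (psi0 \o phi0) \- idfun) projQ0.
  move=> x /=; have /exact0 [z ->] : aug (psi0 (phi0 x) - x) = 0.
    by rewrite linearB psi0P phi0P subrr.
  by exists z.
by exists phi0, psi0, psi1, h0.
Qed.

Lemma comparison1 : exists (phi0 : {linear Q0 -> P 0}) (phi1 : {linear Q1 -> P 1})
    (psi1 : {linear P 1 -> Q1}) (psi2 : {linear P 2 -> Q2})
    (h0 : {linear Q0 -> Q1}) (h1 : {linear Q1 -> Q2}),
  [/\ forall x, res_d P 0 (phi1 x) = phi0 (d0 x),
      forall x, d1 (psi2 x) = psi1 (res_d P 1 x)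
    & forall x, d1 (h1 x) = psi1 (phi1 x) - x - h0 (d0 x)].
Proof.
have [phi0 [psi0 [psi1 [h0 [phi0P psi0P psi1P h0P]]]]] := comparison0.
have [|phi1 phi1P] :=
  projective_lift (d := res_d P 0) (f := phi0 \o d0) projQ1.
  move=> x /=; have /res_exact0 [z ->] : res_aug P (phi0 (d0 x)) = 0.
    by rewrite phi0P aug_d0.
  by exists z.
have [|psi2 psi2P] :=
  projective_lift (d := d1) (f := psi1 \o res_d P 1) (@res_proj _ _ P 2).
  move=> x /=; have /exact1 [z ->] : d0 (psi1 (res_d P 1 x)) = 0.
    by rewrite psi1P dP_d linear0.
  by exists z.
have [|h1 h1P] :=
  projective_lift (d := d1) (f := ((psi1 \o phi1) \- idfun) \- (h0 \o d0)) projQ1.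
  move=> x /=.
  have /exact1 [z ->] : d0 (psi1 (phi1 x) - x - h0 (d0 x)) = 0.
    by rewrite !linearB psi1P phi1P h0P subrr.
  by exists z.
by exists phi0, phi1, psi1, psi2, h0, h1.
Qed.

(* If P stops at degree 1 then the first syzygy of M is projective, so it splits
   off Q1; the splitting is recorded elementwise. *)
Lemma syzygy1_split : (forall x : P 2, x = 0) -> forall x, aug x = 0 ->
  exists y, d0 y = x /\ forall u : R, u *: x = 0 -> u *: y = 0.
Proof.
move=> P2 x augx.
have [phi0 [psi0 [psi1 [h0 [phi0P psi0P psi1P h0P]]]]] := comparison0.
have /res_exact0 [y Dy] : res_aug P (phi0 x) = 0 by rewrite phi0P.
exists (psi1 y - h0 x); split=> [|u ux0].
  by rewrite linearB psi1P -Dy h0P subKr.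
(* Since P 2 vanishes, [res_d P 0] is injective, so whatever kills x also kills the preimage y. *)
have /res_exactS[z Dz] : res_d P 0 (u *: y) = 0 by rewrite linearZ /= -Dy -linearZ ux0 linear0.
by rewrite scalerBr -(linearZ_LR psi1) -(linearZ_LR h0) ux0 Dz [z]P2 !linear0 addr0.
Qed.

(** One degree higher: if P stops at degree 2, the second syzygy, which is the image of d1, is a
    retract of Q2. *)
Lemma syzygy2_split : (forall x : P 3, x = 0) -> forall x, d0 x = 0 ->
  exists y, d1 y = x /\ forall u : R, u *: x = 0 -> u *: y = 0.
Proof.
move=> P3 x d0x.
have [phi0 [phi1 [psi1 [psi2 [h0 [h1 [phi1P psi2P h1P]]]]]]] := comparison1.
have /res_exactS [y Dy] : res_d P 0 (phi1 x) = 0 by rewrite phi1P d0x linear0.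
exists (psi2 y - h1 x); split=> [|u ux0].
  by rewrite linearB psi2P -Dy h1P d0x linear0 subr0 subKr.
have /res_exactS[z Dz] : res_d P 1 (u *: y) = 0 by rewrite linearZ /= -Dy -linearZ ux0 linear0.
by rewrite scalerBr -(linearZ_LR psi2) -(linearZ_LR h1) ux0 Dz [z]P3 !linear0 addr0.
Qed.

(** This moves Ext^2 classes from the explicit resolution to the one hidden in [ext_dim]: pulling
    back along psi preserves cocycles and is injective on classes, which is enough for a lower bound
    on the dimension. *)
Lemma ext2_transfer (N : lmodType R) (d1_inj : forall x, d1 x = 0 -> x = 0) :
  exists (psi : {linear P 2 -> Q2}),
    (forall x, psi (res_d P 2 x) = 0) /\
    forall f : {linear Q2 -> N}, coboundary (fun x : P 2 => f (psi x)) ->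
      exists g : {linear Q1 -> N}, forall x, f x = g (d1 x).
Proof.
have [phi0 [phi1 [psi1 [psi2 [h0 [h1 [phi1P psi2P h1P]]]]]]] := comparison1.
exists psi2; split=> [x|f [g gP]].
  by apply: d1_inj; rewrite psi2P dP_d linear0.
exists ((g \o phi1) \- (f \o h1)) => x /=.
have /res_exactS [y Dy] : res_d P 0 (phi1 (d1 x)) = 0 by rewrite phi1P d0_d1 linear0.
rewrite Dy -gP -linearB; congr (f _); apply/eqP; rewrite -subr_eq0; apply/eqP/d1_inj.
by rewrite !(linearB d1) psi2P -Dy h1P d0_d1 linear0 subr0 subKr subrr.
Qed.
End Comparison.

Lemma pd_le_leq (R : pzRingType) (M : lmodType R) j k : (j <= k)%N -> pd_le M j -> pd_le M k.
Proof.
by move=> jk [P Pv]; exists P => i ki; apply: Pv; exact: leq_ltn_trans ki.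
Qed.

(** * Vector spaces and free modules *)

Section VectorSpaces.
Variables (F : fieldType) (B : algType F).
Implicit Types K X Y : lmodType B.

(** A B-module carries only the action of B, so F acts through the scalars [c%:A]. *)
Definition flinear K X (h : K -> X) : Prop :=
  forall (c : F) x y, h (c%:A *: x + y) = c%:A *: h x + h y.

Definition subspace K (W : K -> Prop) : Prop :=
  W 0 /\ forall (c : F) x y, W x -> W y -> W (c%:A *: x + y).

Lemma subspaceB K (W : K -> Prop) x y : subspace W -> W x -> W y -> W (x - y).
Proof.
case=> _ WP Wx Wy; have := WP (-1) y x Wy Wx.
by rewrite scaleN1r scaleN1r addrC.
Qed.

Lemma flinear0 K X (h : K -> X) : flinear h -> h 0 = 0.
Proof.
by move=> hl; have := hl (-1) 0 0; rewrite scaler0 addr0 !scaleN1r addNr.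
Qed.

Lemma flinearD K X (h : K -> X) : flinear h -> {morph h : x y / x + y}.
Proof. by move=> hl x y; have := hl 1 x y; rewrite !scale1r. Qed.

Lemma flinearZ K X (h : K -> X) : flinear h ->
  forall (c : F) x, h (c%:A *: x) = c%:A *: h x.
Proof. by move=> hl c x; have := hl c x 0; rewrite (flinear0 hl) !addr0. Qed.

Lemma flinearB K X (h : K -> X) : flinear h -> {morph h : x y / x - y}.
Proof.
by move=> hl x y; have := hl (-1) y x; rewrite !scaleN1r ![- _ + _]addrC.
Qed.

Lemma flinear_sum K X (h : K -> X) I (r : seq I) (p : pred I) (f : I -> K) :
  flinear h -> h (\sum_(i <- r | p i) f i) = \sum_(i <- r | p i) h (f i).
Proof. by move=> hl; apply: (big_morph h (flinearD hl) (flinear0 hl)). Qed.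

Lemma scaler_in_comm K (c : F) (b : B) (x : K) :
  b *: (c%:A *: x) = c%:A *: (b *: x).
Proof. by rewrite !scalerA -scalerAr -scalerAl mulr1 mul1r. Qed.

Lemma scaler_alg K (c : F) (b : B) (x : K) : (c *: b) *: x = c%:A *: (b *: x).
Proof. by rewrite scalerA mulr_algl. Qed.

Lemma complement_projection K (W : K -> Prop) : subspace W ->
  exists C : K -> K, [/\ flinear C, forall x, W x -> C x = 0 & forall x, W (x - C x)].
Proof.
move=> subW; have [W0 WP] := subW.
pose Q (U : K -> Prop) : Prop :=
  (forall (c : F) x y, U x -> U y -> U (c%:A *: x + y)) /\
  (forall x, U x -> W x -> x = 0).
have [G GQ Gtot|U [[UP UW] Umax]] := @classical_sets.Zorn_bigcup K Q.
  split=> [c x y [V GV Vx] [V' GV' V'y]|x [V GV Vx]]; last exact: (GQ V GV).2.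
  have [VV'|V'V] := Gtot _ _ GV GV'.
    by exists V' => //; apply: (GQ V' GV').1 => //; exact: VV'.
  by exists V => //; apply: (GQ V GV).1 => //; exact: V'V.
(* Zorn's lemma includes the empty chain, so [Q] admits the empty set and 0 has to be adjoined
   afterwards. *)
pose U0 x := U x \/ x = 0.
have subU0 : subspace U0.
  split=> [|c x y]; first by right.
  move=> [Ux|->] [Uy|->]; rewrite ?scaler0 ?add0r ?addr0; [left; exact: UP| |by left|by right].
  left; have : U 0 by have := UP (-1) x x Ux Ux; rewrite !scaleN1r addNr.
  by move=> U00; have := UP c x 0 Ux U00; rewrite addr0.
have U0W x : U0 x -> W x -> x = 0 by case=> // Ux; apply: UW.
have decomp x : exists u, U0 u /\ W (x - u).
  apply: contrapT => nx.
  pose V v := exists u (c : F), U0 u /\ v = u + c%:A *: x.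
  apply: (Umax V).
    split=> [u Uu|sVU]; first by exists u, 0; split; [left|rewrite scale0r scale0r addr0].
    have Ux : U x by apply: sVU; exists 0, 1; split; [right|rewrite scale1r scale1r add0r].
    by apply: nx; exists x; split; [left|rewrite subrr].
  split=> [c _ _ [u [b [Uu ->]]] [v [b' [Uv ->]]]|_ [u [c [Uu ->]]] Wv].
    exists (c%:A *: u + v), (c * b + b'); split; first exact: subU0.2.
    rewrite scalerDr addrACA; congr (_ + _).
    by rewrite scalerDl scalerDl scalerA -scalerAl mul1r scalerA.
  have [c0|c0] := eqVneq c 0.
    by move: Wv; rewrite c0 scale0r scale0r addr0; apply: U0W.
  case: nx; exists (- (c^-1)%:A *: u); split.
    have := subU0.2 (- c^-1) u 0 Uu subU0.1.
    by rewrite addr0 [(- _) *: 1]scaleNr.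
  have := WP c^-1 _ 0 Wv W0.
  rewrite addr0 scalerDr scalerA -scalerAl mul1r scalerA mulVf // !scale1r.
  by rewrite scaleNr opprK addrC.
have [C CP] := choice decomp.
have Clin : flinear C.
  move=> c x y; apply/eqP; rewrite -subr_eq0; apply/eqP/U0W.
    apply: subspaceB => //; first exact: (CP _).1.
    by apply: subU0.2; exact: (CP _).1.
  have -> : C (c%:A *: x + y) - (c%:A *: C x + C y) =
      (c%:A *: (x - C x) + (y - C y)) - (c%:A *: x + y - C (c%:A *: x + y)).
    by rewrite scalerBr addrACA -opprD opprB [RHS]addrC addrA subrK.
  by apply: subspaceB (CP _).2 => //; apply: WP; exact: (CP _).2.
exists C; split=> // [x Wx|x]; last exact: (CP x).2.
apply: U0W (CP x).1 _; have := subspaceB subW Wx (CP x).2.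
by rewrite subKr.
Qed.

(** An arbitrary choice of preimages becomes linear after a projection that kills the kernel of g,
    because the choice then no longer matters. *)
Lemma linear_section X Y (g : {linear X -> Y}) : exists s : Y -> X,
  (forall x, g (s (g x)) = g x) /\
  (forall (c : F) x y, s (c%:A *: g x + g y) = c%:A *: s (g x) + s (g y)).
Proof.
have [|C [Cl C0 CW]] := @complement_projection X (fun x => g x = 0).
  split=> [|c x y gx gy]; first exact: linear0.
  by rewrite linearP gx gy scaler0 addr0.
have /choice [t tP] (y : Y) : exists x, (exists z, g z = y) -> g x = y.
  by have [[z <-]|nz] := pselect (exists z, g z = y); [exists z|exists 0].
have CE x x' : g x = g x' -> C x = C x'.
  move=> E; apply/eqP; rewrite -subr_eq0 -(flinearB Cl); apply/eqP/C0.
  by rewrite linearB E subrr.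
have gC x : g (C x) = g x.
  by apply/eqP; rewrite eq_sym -subr_eq0 -linearB; apply/eqP/CW.
have tg x : g (t (g x)) = g x by apply: tP; exists x.
exists (C \o t); split=> [x|c x y] /=; first by rewrite gC tg.
rewrite -Cl; apply: CE; rewrite linearP !tg.
by rewrite tP //; exists (c%:A *: x + y); rewrite linearP.
Qed.
End VectorSpaces.

Section FreeModule.
Variables (R : nzRingType).

Definition free_map (K : choiceType) (M : lmodType R) (f : K -> M) (x : {malg R[K]}) : M :=
  \sum_(k <- msupp x) x@_k *: f k.

Lemma free_mapw (K : choiceType) (M : lmodType R) (f : K -> M) (D : {fset K}) x :
  (msupp x `<=` D)%fset -> free_map f x = \sum_(k <- D) x@_k *: f k.
Proof.
move=> le; rewrite /free_map (big_fset_incl _ le) //= => k _ /mcoeff_outdom ->.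
by rewrite scale0r.
Qed.

Fact free_map_linear (K : choiceType) (M : lmodType R) (f : K -> M) : linear (free_map f).
Proof.
move=> c x y; pose D := (msupp x `|` msupp y)%fset.
have sx : (msupp x `<=` D)%fset by rewrite fsubsetUl.
have sy : (msupp y `<=` D)%fset by rewrite fsubsetUr.
have sxy : (msupp (c *: x + y) `<=` D)%fset.
  apply/fsubsetP => k; rewrite in_fsetU -!mcoeff_neq0 mcoeffD mcoeffZ.
  by apply: contraR; rewrite negb_or !negbK => /andP[/eqP -> /eqP ->]; rewrite mulr0 addr0.
rewrite (free_mapw f sx) (free_mapw f sy) (free_mapw f sxy) scaler_sumr -big_split /=.
by apply: eq_bigr => k _; rewrite mcoeffD mcoeffZ scalerDl scalerA.
Qed.
HB.instance Definition _ (K : choiceType) (M : lmodType R) (f : K -> M) :=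
  GRing.isLinear.Build R {malg R[K]} M _ (free_map f) (free_map_linear f).

Lemma free_mapU (K : choiceType) (M : lmodType R) (f : K -> M) k :
  free_map f << 1 *g k >> = f k.
Proof. by rewrite (free_mapw f msuppU_le) big_seq_fset1 mcoeffUU scale1r. Qed.

Lemma free_map_surj (M : lmodType R) y : exists x, free_map (@id M) x = y.
Proof. by exists << 1 *g y >>; rewrite free_mapU. Qed.

Lemma monalgU_scale (K : choiceType) (c : R) (k : K) :
  << c *g k >> = c *: << 1 *g k >> :> {malg R[K]}.
Proof. by apply/malgP => k'; rewrite mcoeffZ !mcoeffU mulrnAr mulr1. Qed.

Lemma free_projective (K : choiceType) : projective ({malg R[K]} : lmodType R).
Proof.
move=> M N g f g_surj.
have [t tP] := choice (fun k : K => g_surj (f << 1 *g k >>)).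
exists (free_map t) => x.
rewrite [x in RHS]monalgE /free_map !linear_sum; apply: eq_bigr => k _.
by rewrite monalgU_scale !linearZ /= tP.
Qed.
End FreeModule.

(** * Modules generated by idempotents *)

Section IdempotentModule.
Variables (R : pzRingType) (eps : R).

Definition mulr_sub (x : R^o) : R^o := x * eps - x.

Fact mulr_sub_linear : linear mulr_sub.
Proof.
by move=> c x y; rewrite /mulr_sub mulrDl opprD addrACA scalerBr -[c *: (x * eps)]/(c * (x * eps)) mulrA.
Qed.
HB.instance Definition _ :=
  GRing.isLinear.Build R R^o R^o _ mulr_sub mulr_sub_linear.

(* R eps, for an idempotent eps. *)
Definition peirce : lmodType R := ker mulr_sub.

Definition peirce_val (x : peirce) : R := ker_val x.

Lemma peirceP (x : peirce) : peirce_val x * eps = peirce_val x.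
Proof. by apply/eqP; rewrite -subr_eq0; apply/eqP/(ker_val_eq0 x). Qed.

Lemma peirce_inj : injective peirce_val.
Proof. exact: val_inj. Qed.

Fact Peirce_subproof (r : R) : r * eps = r -> (r : R^o) \in ker_pred mulr_sub.
Proof. by move=> E; apply/eqP; rewrite /= /mulr_sub E subrr. Qed.

Definition Peirce (r : R) (E : r * eps = r) : peirce := Ker (Peirce_subproof E).

Lemma PeirceE r (E : r * eps = r) : peirce_val (Peirce E) = r. Proof. by []. Qed.

Lemma peirce_val0 : peirce_val 0 = 0. Proof. by rewrite /peirce_val linear0. Qed.

Lemma peirce_valZ c x : peirce_val (c *: x) = c * peirce_val x.
Proof. by rewrite /peirce_val linearZ_LR. Qed.

Lemma peirce_valP c x y :
  peirce_val (c *: x + y) = c * peirce_val x + peirce_val y.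
Proof. by rewrite /peirce_val linearP. Qed.

Definition peirce_gen (M : lmodType R) (m : M) (x : peirce) : M := peirce_val x *: m.

Fact peirce_gen_linear M m : linear (@peirce_gen M m).
Proof. by move=> c x y; rewrite /peirce_gen peirce_valP scalerDl scalerA. Qed.
HB.instance Definition _ (M : lmodType R) (m : M) :=
  GRing.isLinear.Build R peirce M _ (@peirce_gen M m) (@peirce_gen_linear M m).

Hypothesis eps_idem : eps * eps = eps.

(** Since eps generates R eps, a morphism is determined by its value there. *)
Lemma peirce_homE (M : lmodType R) (f : {linear peirce -> M}) x :
  f x = peirce_val x *: f (Peirce eps_idem).
Proof.
rewrite -linearZ_LR; congr (f _); apply: peirce_inj.
by rewrite peirce_valZ PeirceE peirceP.
Qed.

Lemma peirce_projective : projective peirce.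
Proof.
move=> M N g f g_surj; have [m mP] := g_surj (f (Peirce eps_idem)).
exists (peirce_gen m) => x.
by rewrite /= /peirce_gen linearZ_LR mP -peirce_homE.
Qed.
End IdempotentModule.

Section PeirceMul.
Variables (R : pzRingType) (eps eps' y : R).
Hypothesis yP : y * eps' = y.

Fact peirce_mul_subproof (x : peirce eps) :
  (peirce_val x * y) * eps' = peirce_val x * y.
Proof. by rewrite -mulrA yP. Qed.

Definition peirce_mul (x : peirce eps) : peirce eps' :=
  Peirce (peirce_mul_subproof x).

Lemma peirce_mulE x : peirce_val (peirce_mul x) = peirce_val x * y.
Proof. by []. Qed.

Fact peirce_mul_linear : linear peirce_mul.
Proof.
move=> c x z; apply: peirce_inj.
by rewrite peirce_valP !peirce_mulE peirce_valP mulrDl mulrA.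
Qed.
HB.instance Definition _ :=
  GRing.isLinear.Build R (peirce eps) (peirce eps') _ peirce_mul peirce_mul_linear.
End PeirceMul.

Section PeirceResolution.
Variables (R : pzRingType) (M : lmodType R) (eps y : nat -> R) (x0 : M).

(** Data for a resolution of M by the modules R eps_i whose differentials are right multiplications
    by y_i and whose augmentation sends eps_0 to x0. Finite resolutions are sequences that are
    eventually 0. *)
Record peirce_exact : Prop := PeirceExact {
  pe_idem : forall i, eps i * eps i = eps i;
  pe_mul : forall i, y i * eps i = y i;
  pe_mull : forall i, eps i.+1 * y i = y i;
  pe_gen : eps 0 *: x0 = x0;
  pe_surj : forall m, exists r, r *: x0 = m;
  pe_comp0 : y 0 *: x0 = 0;
  pe_compS : forall i, y i.+1 * y i = 0;
  pe_exact0 : forall r, r * eps 0 = r -> r *: x0 = 0 ->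
    exists z, z * eps 1 = z /\ r = z * y 0;
  pe_exactS : forall i r, r * eps i.+1 = r -> r * y i = 0 ->
    exists z, z * eps i.+2 = z /\ r = z * y i.+1 }.

Hypothesis ex : peirce_exact.

Definition peirce_resolution : proj_resolution M.
Proof.
refine (@ProjResolution R M (fun i => peirce (eps i))
  (fun i => peirce_mul (eps := eps i.+1) (pe_mul ex i)) (peirce_gen (eps := eps 0) x0) _ _ _ _).
- by move=> i; apply: peirce_projective; exact: pe_idem.
- move=> m; have [r <-] := pe_surj ex m.
  have E : (r * eps 0) * eps 0 = r * eps 0 by rewrite -mulrA (pe_idem ex).
  by exists (Peirce E); rewrite /= /peirce_gen PeirceE -scalerA (pe_gen ex).
- move=> x; split=> [/= x00|[z ->]]; last first.
    by rewrite /= /peirce_gen peirce_mulE -scalerA (pe_comp0 ex) scaler0.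
  have [z [zP E]] := pe_exact0 ex (peirceP x) x00.
  by exists (Peirce zP); apply: peirce_inj; exact: E.
- move=> i x; split=> [/= /(congr1 (@peirce_val _ _))|[z ->]]; last first.
    apply: peirce_inj; rewrite peirce_val0 -[LHS]/((peirce_val z * y i.+1) * y i).
    by rewrite -mulrA (pe_compS ex) mulr0.
  rewrite peirce_mulE peirce_val0 => E.
  have [z [zP E']] := pe_exactS ex (peirceP x) E.
  by exists (Peirce zP); apply: peirce_inj; exact: E'.
Defined.

Lemma peirce_pd_le k : (forall i, (k < i)%N -> eps i = 0) -> pd_le M k.
Proof.
move=> epsk; exists peirce_resolution => i ki x; apply: peirce_inj.
by rewrite peirce_val0 -[LHS]peirceP [X in _ * X](epsk i ki) mulr0.
Qed.
End PeirceResolution.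

Section PeirceExt.
Variables (F : fieldType) (B : algType F) (M : lmodType B).
Variables (eps y : nat -> B) (x0 : M).
Hypothesis ex : peirce_exact eps y x0.

(** Evaluation at the generator identifies Hom(B eps_i, B) with eps_i B, and the differential
    becomes left multiplication by y_i. The Ext computations below are carried out in this form. *)
Lemma peirce_cocycle i (f : {linear peirce (eps i) -> B^o}) :
  cocycle (P := peirce_resolution ex) (i := i) f ->
  let t := f (Peirce (pe_idem ex i)) : B in eps i * t = t /\ y i * t = 0.
Proof.
move=> fc t; split.
  rewrite /t -[eps i * _]/(eps i *: f _) -linearZ_LR; congr (f _).
  by apply: peirce_inj; rewrite peirce_valZ PeirceE (pe_idem ex).
have := fc (Peirce (pe_idem ex i.+1)).
rewrite (peirce_homE (pe_idem ex i)) => <-.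
exact: (congr1 (fun r => r * t) (esym (pe_mull ex i))).
Qed.

Lemma peirce_ext0_vanish :
  (forall t, eps 0 * t = t -> y 0 * t = 0 -> t = 0) ->
  ext_dim M (B^o : lmodType B) 0 0.
Proof.
(* The basis is indexed by the empty ['I_0], so the value given here is a placeholder. *)
move=> tP; exists (peirce_resolution ex), (fun=> peirce_gen (eps := eps 0) (0 : B^o)).
split=> [[]//|f fc]; have [t1 t2] := peirce_cocycle fc.
exists [ffun=> 0]; split=> [x|c _]; last by apply/ffunP => -[].
by rewrite big_ord0 subr0 (peirce_homE (pe_idem ex 0)) (tP _ t1 t2) scaler0.
Qed.

Lemma peirce_ext_vanish i :
  (forall t, eps i.+1 * t = t -> y i.+1 * t = 0 -> exists s, t = y i * s) ->
  ext_dim M (B^o : lmodType B) i.+1 0.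
Proof.
move=> tP; exists (peirce_resolution ex), (fun=> peirce_gen (eps := eps i.+1) (0 : B^o)).
split=> [[]//|f fc]; have [t1 t2] := peirce_cocycle fc.
exists [ffun=> 0]; split=> [|c _]; last by apply/ffunP => -[].
have [s sE] := tP _ t1 t2.
exists (peirce_gen (eps := eps i) (s : B^o)) => x /=.
rewrite big_ord0 subr0 (peirce_homE (pe_idem ex i.+1)) sE.
exact: (mulrA (peirce_val x) (y i) s).
Qed.

(** When the next differential vanishes, all of eps_(i+1) B consists of cocycles, so Ext is the
    cokernel of left multiplication by y_i, with the class of eps_(i+1) as basis. *)
Lemma peirce_ext_line i : y i.+1 = 0 ->
  (forall t, eps i.+1 * t = t ->
     exists! c : F, exists s, t - c *: eps i.+1 = y i * s) ->
  ext_dim M (B^o : lmodType B) i.+1 1.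
Proof.
move=> y0 tP.
exists (peirce_resolution ex), (fun=> peirce_gen (eps := eps i.+1) (eps i.+1 : B^o)).
split=> [j x|f fc].
  rewrite -[LHS]/((peirce_val x * y i.+1) * eps i.+1).
  by rewrite y0 mulr0 mul0r.
have [t1 t2] := peirce_cocycle fc.
have [c [[s sP] c_uniq]] := tP _ t1.
have cobE (k : {ffun 'I_1 -> F}) x :
    f x - \sum_j (k j)%:A *: peirce_gen (eps i.+1 : B^o) x =
    peirce_val x * ((f (Peirce (pe_idem ex i.+1)) : B) - k ord0 *: eps i.+1).
  rewrite big_ord1 (peirce_homE (pe_idem ex i.+1) f) /peirce_gen -scaler_in_comm.
  rewrite -scalerBr -(mulr_algl (k ord0) (eps i.+1)).
  by [].
exists [ffun=> c]; split=> [|k [g gP]].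
  exists (peirce_gen (eps := eps i) (s : B^o)) => x.
  by rewrite /= cobE ffunE sP mulrA.
apply/ffunP => j; rewrite ffunE (ord1 j); apply: c_uniq.
exists (g (Peirce (pe_idem ex i))).
have := gP (Peirce (pe_idem ex i.+1)); rewrite cobE PeirceE.
rewrite (peirce_homE (pe_idem ex i) g) mulrBr t1 -scalerAr (pe_idem ex) => ->.
exact: (congr1 (fun r => r * _) (pe_mull ex i)).
Qed.
End PeirceExt.

(** * Nakayama algebras *)

Section NilpotentElement.
Variables (F : fieldType) (B : algType F) (a : B) (N : nat).
Hypothesis aN : a ^+ N = 0.

Lemma horner_algE (p : {poly F}) :
  horner_alg a p = \sum_(i < size p) p`_i *: a ^+ i.
Proof.
rewrite -[in LHS](coefK p) poly_def rmorph_sum; apply: eq_bigr => i _.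
by rewrite /= linearZ /= rmorphXn /= horner_algX mulr_algl.
Qed.

(* p = X^k q with q invertible modulo X^N, so p(a) and a^k divide each other. *)
Lemma nilpotent_horner_dvd (p : {poly F}) l : p`_l != 0 ->
  exists q, a ^+ l = horner_alg a q * horner_alg a p.
Proof.
move=> pl; have p0 : p != 0 by apply: contraNneq pl => ->; rewrite coef0.
have [k [q q0 pE]] := multiplicity_XsubC p 0.
rewrite subr0 p0 /= in pE q0.
have kl : (k <= l)%N.
  by rewrite leqNgt; apply: contra pl => lk; rewrite pE coefMXn lk.
have /Bezout_eq1_coprimepP [[u v] /= uv] : coprimep q ('X^N).
  by apply: coprimep_expr; rewrite coprimepX.
exists (u * 'X^(l - k)); rewrite -rmorphM pE.
have -> : u * 'X^(l - k) * (q * 'X^k) = (1 - v * 'X^N) * 'X^l.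
  by rewrite -uv addrK mulrACA -exprD subnK.
rewrite rmorphM rmorphB rmorph1 rmorphM /= !rmorphXn /= horner_algX aN.
by rewrite mulr0 subr0 mul1r.
Qed.

(** Every a^l with l in the support of p is a multiple of p(a), so annihilation can be tested on
    monomials even when x is not homogeneous. *)
Lemma horner_mul_eq0 (p : {poly F}) (x : B) : 
  horner_alg a p * x = 0 <-> forall l, p`_l != 0 -> a ^+ l * x = 0.
Proof.
split=> [px l /nilpotent_horner_dvd [q ->]|px]; first by rewrite -mulrA px mulr0.
rewrite horner_algE mulr_suml big1 // => i _; rewrite -scalerAl.
by have [->|/px ->] := eqVneq p`_i 0; rewrite ?scale0r ?scaler0.
Qed.

Lemma mul_horner_eq0 (p : {poly F}) (x : B) : 
  x * horner_alg a p = 0 <-> forall l, p`_l != 0 -> x * a ^+ l = 0.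
Proof.
split=> [px l /nilpotent_horner_dvd [q ->]|px].
  by rewrite -rmorphM mulrC rmorphM mulrA px mul0r.
rewrite horner_algE mulr_sumr big1 // => i _; rewrite -scalerAr.
by have [->|/px ->] := eqVneq p`_i 0; rewrite ?scale0r ?scaler0.
Qed.
End NilpotentElement.

(* B acts on the left, so right modules over the path algebra quotient A are
   treated with B := A^c. The element a is the sum of all arrows: the path of
   length l starting at j is a^l e_j, and s j is the successor of j. The linear
   quiver is regarded as a cyclic quiver with one vanishing arrow. *)
Record nakayama (F : fieldType) (B : algType F) (V : finType) (s s' : V -> V)
    (e : V -> B) (a : B) (N : nat) : Prop := Nakayama {
  nak_sK : cancel s s';
  nak_s'K : cancel s' s;
  nak_sum : \sum_j e j = 1;
  nak_idem : forall i j, e i * e j = if i == j then e i else 0;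
  nak_comm : forall j, a * e j = e (s j) * a;
  nak_nil : a ^+ N = 0;
  nak_span : forall x, exists p : V -> {poly F}, x = \sum_j horner_alg a (p j) * e j }.

Section NakayamaTheory.
Variables (F : fieldType) (B : algType F) (V : finType) (s s' : V -> V).
Variables (e : V -> B) (a : B) (N : nat).
Hypothesis nakB : nakayama s s' e a N.
Implicit Types (K X Y M : lmodType B) (i j : V) (l : nat).

Lemma nak_eK j : e j * e j = e j.
Proof. by rewrite (nak_idem nakB) eqxx. Qed.

Lemma nak_eM0 i j : i != j -> e i * e j = 0.
Proof. by rewrite (nak_idem nakB) => /negPf ->. Qed.

Lemma nak_commX l j : a ^+ l * e j = e (iter l s j) * a ^+ l.
Proof.
elim: l => [|l IHl]; first by rewrite mul1r mulr1.
by rewrite exprS -mulrA IHl mulrA (nak_comm nakB) -mulrA.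
Qed.

Lemma nak_commV j : e j * a = a * e (s' j).
Proof. by rewrite (nak_comm nakB) (nak_s'K nakB). Qed.

Lemma nak_iterK l : cancel (iter l s) (iter l s').
Proof.
by move=> j; elim: l j => // l IHl j; rewrite iterSr iterS (nak_sK nakB) IHl.
Qed.

Lemma nak_iter'K l : cancel (iter l s') (iter l s).
Proof.
by move=> j; elim: l j => // l IHl j; rewrite iterSr iterS (nak_s'K nakB) IHl.
Qed.

Lemma nak_commXV l j : e j * a ^+ l = a ^+ l * e (iter l s' j).
Proof. by rewrite nak_commX nak_iter'K. Qed.

Lemma nak_right x j : x * e j = x -> exists p, x = horner_alg a p * e j.
Proof.
have [p -> xj] := nak_span nakB x; exists (p j); rewrite -xj mulr_suml.
rewrite (bigD1 j) //= big1 ?addr0 => [|i ij]; first by rewrite -mulrA nak_eK.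
by rewrite -mulrA nak_eM0 ?mulr0.
Qed.

(** The span has its idempotents on the right. Each a^l e_i is rewritten as e_(s^l i) a^l, and
    multiplication by e_j keeps it only if s^l i = j. *)
Lemma nak_left x j : e j * x = x -> exists p, x = e j * horner_alg a p.
Proof.
have [q -> <-] := nak_span nakB x.
pose Z y := exists p : {poly F}, e j * y = e j * horner_alg a p.
suff : Z (\sum_i horner_alg a (q i) * e i) by [].
apply: big_ind => [|y y' [p Ep] [p' Ep']|i _]; first by exists 0; rewrite rmorph0.
  by exists (p + p'); rewrite mulrDr Ep Ep' -mulrDr rmorphD.
rewrite (horner_algE a) mulr_suml; apply: big_ind => [|y y' [p Ep] [p' Ep']|l _].
- by exists 0; rewrite rmorph0.
- by exists (p + p'); rewrite mulrDr Ep Ep' -mulrDr rmorphD.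
have [E|ne] := eqVneq j (iter l s i).
  exists ((q i)`_l *: 'X^l); rewrite linearZ /= rmorphXn /= horner_algX mulr_algl.
  by rewrite -scalerAl nak_commX -E -scalerAr mulrA nak_eK -scalerAr.
by exists 0; rewrite rmorph0 mulr0 -scalerAl -scalerAr nak_commX mulrA nak_eM0 // mul0r scaler0.
Qed.

(** Thus B a lies in a B, which makes a M a submodule of every module M. *)
Lemma nak_mulr_a x : exists x', x * a = a * x'.
Proof.
have [p ->] := nak_span nakB x; exists (\sum_j horner_alg a (p j) * e (s' j)).
rewrite mulr_suml mulr_sumr; apply: eq_bigr => j _.
rewrite -mulrA nak_commV !mulrA; congr (_ * _).
have aX : a = horner_alg a 'X by rewrite horner_algX.
by rewrite [X in _ * X = _]aX [X in _ = X * _]aX -!rmorphM mulrC.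
Qed.

Lemma nak_decomp K (x : K) : x = \sum_j e j *: x.
Proof. by rewrite -scaler_suml (nak_sum nakB) scale1r. Qed.

(** The scalars, the idempotents and a generate B, so linearity need only be tested on them. *)
Lemma nak_graded_linear K X (h : K -> X) : flinear h ->
  (forall j x, h (e j *: x) = e j *: h x) -> (forall x, h (a *: x) = a *: h x) ->
  linear h.
Proof.
move=> hl he ha.
have haX l x : h (a ^+ l *: x) = a ^+ l *: h x.
  by elim: l x => [|l IHl] x; rewrite ?scale1r // exprS -!scalerA ha IHl.
have hp (p : {poly F}) x : h (horner_alg a p *: x) = horner_alg a p *: h x.
  rewrite horner_algE !scaler_suml (flinear_sum _ _ _ hl); apply: eq_bigr => i _.
  by rewrite !(scaler_alg _ (a ^+ i)) (flinearZ hl) haX.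
move=> b x y; rewrite (flinearD hl); congr (_ + _).
have [p ->] := nak_span nakB b.
rewrite !scaler_suml (flinear_sum _ _ _ hl); apply: eq_bigr => j _.
by rewrite -!scalerA hp he.
Qed.

(** Only the components from e_(t j) K to e_j X are kept. With t the identity the result commutes
    with the idempotents; with t = s it moves one arrow back. *)
Lemma flinear_graded K X (h : K -> X) (t : V -> V) : flinear h ->
  flinear (fun x => \sum_j e j *: h (e (t j) *: x)).
Proof.
move=> hl c x y; rewrite scaler_sumr -big_split; apply: eq_bigr => j _ /=.
by rewrite scalerDr scaler_in_comm hl scalerDr scaler_in_comm.
Qed.

Lemma nak_sum_e K (f : V -> K) i : e i *: (\sum_j e j *: f j) = e i *: f i.
Proof.
rewrite scaler_sumr (bigD1 i) //= big1 ?addr0 => [|j ji].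
  by rewrite scalerA nak_eK.
by rewrite scalerA nak_eM0 1?eq_sym // scale0r.
Qed.

(* A Tor_1-vanishing condition: it makes the recursion along the arrows in
   torsion_lift independent of choices. *)
Definition quadratic_torsion K : Prop := forall j (x : K), a * e j != 0 ->
  e j *: x = x -> a *: x = 0 ->
  x = 0 \/ exists w, a ^+ 2 * e (s' j) = 0 /\ x = a *: (e (s' j) *: w).

Section Lift.
Variables (K X Y : lmodType B) (g : {linear X -> Y}) (f : {linear K -> Y}).
Hypotheses (g_surj : forall y, exists x, g x = y) (Ktor : quadratic_torsion K).

Lemma graded_section : exists l : K -> X,
  [/\ flinear l, forall j x, l (e j *: x) = e j *: l x & forall x, g (l x) = f x].
Proof.
have [sg [sgP sgl]] := linear_section g.
have sgE y : g (sg y) = y by have [x <-] := g_surj y; exact: sgP.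
have sfl : flinear (sg \o f).
  move=> c x y /=; rewrite linearP.
  by have [x1 <-] := g_surj (f x); have [y1 <-] := g_surj (f y).
have sg0 : sg 0 = 0 by have := flinear0 sfl; rewrite /= linear0.
exists (fun x => \sum_j e j *: (sg \o f) (e j *: x)); split.
- exact: (flinear_graded id).
- move=> i x /=; rewrite (nak_sum_e (fun j => sg (f (e j *: x)))).
  rewrite (bigD1 i) //= big1 ?addr0 => [|j ji]; first by rewrite scalerA nak_eK.
  by rewrite scalerA nak_eM0 // scale0r (linear0 f) sg0 scaler0.
- move=> x; rewrite linear_sum [in RHS](nak_decomp x) linear_sum; apply: eq_bigr => j _ /=.
  by rewrite linearZ_LR sgE -linearZ_LR scalerA nak_eK.
Qed.

Lemma graded_radical_section : exists (C T : K -> K),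
  [/\ flinear C /\ flinear T, forall j x, C (e j *: x) = e j *: C x,
      forall j x, T (e j *: x) = e (s' j) *: T x, forall x, C (a *: x) = 0
    & forall x, x = C x + a *: T x].
Proof.
have [|C0 [C0l C0a C0r]] := @complement_projection F B K (fun x => exists y, x = a *: y).
  split=> [|c _ _ [y ->] [z ->]]; first by exists 0; rewrite scaler0.
  by exists (c%:A *: y + z); rewrite scalerDr scaler_in_comm.
pose C x := \sum_j e j *: C0 (e j *: x).
have Cl : flinear C by exact: (flinear_graded id).
have Ce j x : C (e j *: x) = e j *: C x.
  rewrite /C nak_sum_e (bigD1 j) //= big1 ?addr0 => [|i ij]; first by rewrite scalerA nak_eK.
  by rewrite scalerA nak_eM0 // scale0r (flinear0 C0l) scaler0.
have Ca x : C (a *: x) = 0.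
  rewrite /C big1 // => j _; rewrite C0a ?scaler0 //.
  by exists (e (s' j) *: x); rewrite !scalerA nak_commV.
have Cr x : exists y, x - C x = a *: y.
  have /choice [y yP] j := C0r (e j *: x).
  exists (\sum_j e (s' j) *: y j); rewrite [X in X - _](nak_decomp x) -sumrB scaler_sumr.
  apply: eq_bigr => j _; rewrite scalerA -nak_commV -scalerA -yP scalerBr scalerA.
  by rewrite nak_eK.
(* Division by a is made F-linear by composing a choice of quotients with a projection D that kills
   the kernel of a; the product with a is unchanged, since a kills x - D x. *)
have [T0 [T0l T0P]] : exists T0 : K -> K, flinear T0 /\ forall x, x - C x = a *: T0 x.
  have [D [Dl D0 Dr]] : exists D : K -> K,
    [/\ flinear D, forall x, a *: x = 0 -> D x = 0 & forall x, a *: (x - D x) = 0].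
    apply: complement_projection; split=> [|c x y xa ya]; first by rewrite scaler0.
    by rewrite scalerDr scaler_in_comm xa ya scaler0 addr0.
  have [t tP] := choice Cr.
  exists (D \o t); split=> [c x y|x] /=; last first.
    by apply/eqP; rewrite tP -subr_eq0 -scalerBr Dr.
  rewrite -Dl; apply/eqP; rewrite -subr_eq0 -(flinearB Dl); apply/eqP/D0.
  rewrite scalerBr -tP scalerDr scaler_in_comm -!tP Cl scalerBr.
  by rewrite [X in _ - X]addrACA -opprD subrr.
exists C, (fun x => \sum_j e j *: T0 (e (s j) *: x)); split=> //.
- by split=> //; exact: flinear_graded.
- move=> i x; rewrite nak_sum_e (nak_s'K nakB) (bigD1 (s' i)) //= (nak_s'K nakB) big1.
    by rewrite addr0 scalerA nak_eK.
  move=> j ji; rewrite scalerA nak_eM0 ?scale0r ?(flinear0 T0l) ?scaler0 //.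
  by apply: contraNneq ji => <-; rewrite (nak_sK nakB).
- move=> x; apply/eqP; rewrite addrC -subr_eq; apply/eqP.
  rewrite scaler_sumr [in LHS](nak_decomp (x - C x)).
  rewrite (reindex s) /=; last by exists s' => j _; rewrite ?(nak_sK nakB) ?(nak_s'K nakB).
  apply: eq_bigr => j _; rewrite scalerA (nak_comm nakB) -scalerA -T0P Ce -scalerBr.
  by rewrite scalerA nak_eK.
Qed.

(** The lift should satisfy h x = l (C x) + a h (T x). Iteration from 0 stabilises after N rounds,
    because round t changes the value only by a multiple of a^t. *)
Lemma torsion_lift : exists h : {linear K -> X}, forall x, g (h x) = f x.
Proof.
have [l [ll le lP]] := graded_section.
(* C projects K onto a complement of its radical a K, and T divides x - C x by a. *)
have [C [T [[Cl Tl] Ce Te Ca CT]]] := graded_radical_section.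
pose h := fix h t x := if t is t'.+1 then l (C x) + a *: h t' (T x) else 0.
have hl t : flinear (h t).
  elim: t => [|t IHt] c x y /=; first by rewrite scaler0 addr0.
  by rewrite Cl Tl ll IHt !scalerDr scaler_in_comm addrACA.
have he t j x : h t (e j *: x) = e j *: h t x.
  elim: t j x => [|t IHt] j x /=; first by rewrite scaler0.
  by rewrite Ce le Te IHt scalerDr !scalerA nak_commV.
(* T (a x) and x differ by some u with a u = 0. By the torsion condition, each e_j u with a e_j
   nonzero is 0 or of the form a w coming from a relation a^2 e = 0; in every case a h annihilates
   it. *)
have ha t x : h t.+1 (a *: x) = a *: h t x.
  elim: t x => [|t IHt] x; first by rewrite /= Ca (flinear0 ll) scaler0 addr0.
  rewrite /= Ca (flinear0 ll) add0r -/(h t.+1 _).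
  pose u := T (a *: x) - x.
  have au : a *: u = 0.
    by rewrite scalerBr; move: (CT (a *: x)); rewrite Ca add0r => <-; rewrite subrr.
  suff : a *: h t.+1 u = 0.
    by rewrite /u (flinearB (hl _)) scalerBr => /eqP; rewrite subr_eq0 => /eqP.
  rewrite (nak_decomp u) (flinear_sum _ _ _ (hl _)) scaler_sumr big1 // => j _.
  have [aj|aj] := eqVneq (a * e j) 0; first by rewrite he scalerA aj scale0r.
  have [||->|[w [a2 ->]]] := Ktor (j := j) (x := e j *: u) aj.
  - by rewrite scalerA nak_eK.
  - by rewrite scalerA (nak_comm nakB) -scalerA au scaler0.
  - by rewrite (flinear0 (hl _)) scaler0.
  - by rewrite IHt he !scalerA -[a * a]expr2 a2 scale0r.
have hdiff t x : h t.+1 x - h t x = a ^+ t *: h 1 (iter t T x).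
  elim: t x => [|t IHt] x; first by rewrite subr0 scale1r.
  rewrite -/(l (C x) + a *: h t.+1 (T x)) -[h t.+1 x]/(l (C x) + a *: h t (T x)).
  by rewrite opprD addrACA subrr add0r -scalerBr IHt scalerA -exprS iterSr.
(* Stabilisation removes the index shift in [ha], so that the N-th iterate itself commutes with
   a. *)
have hN x : h N.+1 x = h N x.
  by apply/eqP; rewrite -subr_eq0 hdiff (nak_nil nakB) scale0r.
have gh t x : f x - g (h t x) = a ^+ t *: f (iter t T x).
  elim: t x => [|t IHt] x; first by rewrite /= linear0 subr0 scale1r.
  rewrite [X in f X - _]CT /= (linearD f) (linearD g) (linearZ_LR f) (linearZ_LR g) lP opprD addrACA subrr add0r.
  by rewrite -scalerBr IHt scalerA -exprS -iterSr.
have hN_lin : linear (h N).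
  apply: nak_graded_linear (hl N) (he N) _ => x.
  by rewrite -ha hN.
pose hL : {linear K -> X} := HB.pack (h N) (GRing.isLinear.Build _ _ _ _ _ hN_lin).
exists hL => x.
by apply/eqP; rewrite eq_sym -subr_eq0 gh (nak_nil nakB) scale0r.
Qed.
End Lift.

Lemma torsion_projective K : quadratic_torsion K -> projective K.
Proof. by move=> Kt X Y g f g_surj; exact: torsion_lift. Qed.
End NakayamaTheory.

Section Converse.
Variables (F : fieldType) (B : algType F).

Lemma converse_exp (x : B) l : (x : B^c) ^+ l = x ^+ l.
Proof. by elim: l => // l IHl; rewrite exprSr IHl exprS. Qed.

Lemma converse_horner (x : B) (p : {poly F}) :
  horner_alg (x : B^c) p = horner_alg x p.
Proof.
by rewrite !horner_algE; apply: eq_bigr => i _; rewrite converse_exp.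
Qed.

Variables (V : finType) (s s' : V -> V) (e : V -> B) (a : B) (N : nat).

(** Reversing the multiplication reverses the arrows, which exchanges s and s'; the spanning clause
    then needs the idempotents on the other side, as [nak_left] provides. *)
Lemma nakayama_converse :
  nakayama s s' e a N -> nakayama (B := B^c) s' s e a N.
Proof.
move=> nakB; split.
- exact: nak_s'K nakB.
- exact: nak_sK nakB.
- exact: nak_sum nakB.
- by move=> i j; rewrite -[LHS]/(e j * e i) (nak_idem nakB) eq_sym; case: eqP => // ->.
- by move=> j; rewrite -[LHS]/(e j * a) (nak_commV nakB).
- by rewrite converse_exp (nak_nil nakB).
- move=> x.
  pose Z (x : B) := exists p : V -> {poly F}, x = \sum_j e j * horner_alg a (p j).
  have [p pE] : Z x; last first.
    by exists p; rewrite pE; apply: eq_bigr => j _; rewrite converse_horner.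
  rewrite [x](_ : _ = \sum_j e j * x); last by rewrite -mulr_suml (nak_sum nakB) mul1r.
  have /choice [p pE] j : exists p, e j * x = e j * horner_alg a p.
    have [|p ->] := nak_left nakB (x := e j * x) (j := j).
      by rewrite mulrA (nak_eK nakB).
    by exists p.
  by exists p; apply: eq_bigr => j _.
Qed.
End Converse.

Lemma poly_mulXn (F : fieldType) (p : {poly F}) r : (forall l, (l < r)%N -> p`_l = 0) ->
  exists q, p = q * 'X^r.
Proof.
move=> pr; exists (drop_poly r p); rewrite -[LHS](poly_take_drop r p).
rewrite [take_poly r p](_ : _ = 0) ?add0r //; apply/polyP => i.
by rewrite coef_take_poly coef0; case: ltnP => // /pr.
Qed.

Lemma pd_le2 (R : pzRingType) (M P0 P1 P2 : lmodType R) (aug : {linear P0 -> M})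
    (d0 : {linear P1 -> P0}) (d1 : {linear P2 -> P1}) :
  projective P0 -> projective P1 -> projective P2 ->
  (forall y, exists x, aug x = y) ->
  (forall x, aug x = 0 <-> exists y, x = d0 y) ->
  (forall x, d0 x = 0 <-> exists y, x = d1 y) ->
  (forall x, d1 x = 0 -> x = 0) -> pd_le M 2.
Proof.
move=> pr0 pr1 pr2 surj ex0 ex1 inj.
(* The resolution is continued by zero modules, realised as R eps with eps = 0. *)
have Z_eq0 (x : peirce (0 : R)) : x = 0.
  by apply: peirce_inj; rewrite peirce_val0 -[LHS]peirceP mulr0.
pose P i : lmodType R :=
  match i with 0 => P0 | 1 => P1 | 2 => P2 | _ => peirce 0 end.
pose d i : {linear P i.+1 -> P i} :=
  match i with 0 => d0 | 1 => d1 | 2 => \0 | _ => \0 end.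
unshelve eexists (@ProjResolution R M P d aug _ surj ex0 _).
- by case=> [|[|[|i]]] //=; apply: peirce_projective; rewrite mulr0.
- case=> [|[|i]] //= x.
    by split=> [/inj ->|[y ->]]; [exists 0 | exact: linear0].
  by split=> _; [exists 0; exact: Z_eq0 | rewrite (Z_eq0 x) linear0].
- by case=> [|[|[|i]]].
Qed.

(** * Quadratic relations without overlaps *)

Section Quadratic.
Variables (F : fieldType) (B : algType F) (V : finType) (s s' : V -> V).
Variables (e : V -> B) (a : B) (N : nat).
Hypothesis nakB : nakayama s s' e a N.
Implicit Types (K M S : lmodType B) (i j : V) (l : nat).

(* All relations of the bound quiver are generated by paths of length 2. *)
Definition quadratic : Prop := forall j l, (0 < l)%N -> a ^+ l * e j != 0 ->
  a ^+ 2 * e (iter l.-1 s j) != 0 -> a ^+ l.+1 * e j != 0.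

(** Two zero relations of length 2 that share an arrow would give the simple at j a nonzero third
    syzygy. *)
Definition no_overlap : Prop := forall j, a * e j != 0 -> a * e (s j) != 0 ->
  a * e (s (s j)) != 0 -> a ^+ 2 * e j = 0 -> a ^+ 2 * e (s j) != 0.

Hypotheses (quadB : quadratic) (novB : no_overlap).

Lemma path_prefix j l m : (m <= l)%N -> a ^+ l * e j != 0 -> a ^+ m * e j != 0.
Proof.
by move=> ml; apply: contraNneq => E; rewrite -(subnK ml) exprD -mulrA E mulr0.
Qed.

Lemma path_shift j l m : a ^+ (l + m) * e j != 0 -> a ^+ l * e (iter m s j) != 0.
Proof.
apply: contraNneq => E.
by rewrite exprD -mulrA (nak_commX nakB) mulrA E mul0r.
Qed.

(** [quadratic] lengthens a path at its end. To lengthen it at its start, the path is rebuilt arrow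
    by arrow from its first two arrows. *)
Lemma quadratic_prepend j l : (0 < l)%N -> a ^+ l * e (s j) != 0 ->
  a ^+ 2 * e j != 0 -> a ^+ l.+1 * e j != 0.
Proof.
move=> l0 al a2.
suff H k : (k < l)%N -> a ^+ k.+2 * e j != 0 by case: l l0 al H => // l _ _; apply.
elim: k => // k IHk kl; apply: quadB => //; first by apply: IHk; exact: ltnW.
rewrite /= -iterS iterSr; apply: path_shift; exact: path_prefix al.
Qed.

(** The torsion condition for B itself. The alternative depends on j alone and not on x, so it
    passes to free modules coefficientwise. *)
Lemma left_torsion j : a * e j != 0 ->
  (forall x, e j * x = x -> a * x = 0 -> x = 0) \/
  (a * e (s' j) != 0 /\ a ^+ 2 * e (s' j) = 0 /\
   forall x, e j * x = x -> a * x = 0 -> exists w, x = a * (e (s' j) * w)).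
Proof.
move=> aj.
have coefP x : e j * x = x -> a * x = 0 ->
    exists2 p, x = e j * horner_alg a p & forall l, p`_l != 0 -> a * e j * a ^+ l = 0.
  move=> xj ax; have [p xE] := nak_left nakB xj; exists p => //.
  by apply/(mul_horner_eq0 (nak_nil nakB)); rewrite -mulrA -xE.
have coef0 p : (forall l, p`_l != 0 -> a * e j * a ^+ l = 0) -> p`_0 = 0.
  by move=> pP; apply: contraNeq aj => /pP; rewrite mulr1 => ->.
case: (boolP ((a * e (s' j) != 0) && (a ^+ 2 * e (s' j) == 0))) => [/andP[a1 /eqP a2]|H].
  right; split=> //; split=> // x xj ax; have [p -> pP] := coefP x xj ax.
  have [|q ->] := @poly_mulXn F p 1; first by case=> // _; exact: coef0.
  exists (horner_alg a q); rewrite mulrC rmorphM /= horner_algX !mulrA.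
  by rewrite (nak_commV nakB).
left=> x xj ax; have [p -> pP] := coefP x xj ax.
apply/(mul_horner_eq0 (nak_nil nakB)) => l pl; apply: contra_eq (pP l pl) => ajl.
have l0 : (0 < l)%N by case: l pl {ajl} => //; rewrite coef0 ?eqxx.
have El : iter l.-1 s (iter l s' j) = s' j.
  by rewrite -{2}(prednK l0) iterSr (nak_iter'K nakB).
rewrite -mulrA (nak_commXV nakB) mulrA -exprS; apply: quadB => //.
  by rewrite -(nak_commXV nakB).
rewrite El; move: H; rewrite negb_and negbK => /orP[/eqP a1|//].
by case/eqP: ajl; rewrite -(prednK l0) exprS mulrA (nak_commV nakB) a1 mul0r.
Qed.

Lemma free_torsion (T : choiceType) :
  quadratic_torsion s' e a ({malg B[T]} : lmodType B).
Proof.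
move=> j x aj xj ax.
have xjk k : e j * x@_k = x@_k by rewrite -mcoeffZ xj.
have axk k : a * x@_k = 0 by rewrite -mcoeffZ ax mcoeff0.
have [H|[a1 [a2 H]]] := left_torsion aj.
  by left; apply/malgP => k; rewrite mcoeff0; exact: H.
right; have /choice [w wP] k := H _ (xjk k) (axk k).
exists (\sum_(k <- msupp x) << w k *g k >>); split=> //.
have scale_sum b (f : T -> {malg B[T]}) :
    b *: (\sum_(k <- msupp x) f k) = \sum_(k <- msupp x) b *: f k.
  exact: scaler_sumr.
rewrite [LHS]monalgE 2!scale_sum; apply: eq_bigr => k _; apply/malgP => k'.
by rewrite !mcoeffZ !mcoeffU !mulrnAr -wP.
Qed.

(** The divisor w supplied by K must be shown to lie in the kernel. Its image under d is killed by
    a; if it were nonzero, it would come from a second zero relation overlapping the first. *)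
Lemma kernel_torsion K M (d : {linear K -> M}) :
  quadratic_torsion s' e a K -> quadratic_torsion s' e a M ->
  quadratic_torsion s' e a (ker d).
Proof.
move=> Kt Mt j x aj xj ax.
have valZ b (z : ker d) : ker_val (b *: z) = b *: ker_val z by rewrite linearZ_LR.
have val0 : ker_val (0 : ker d) = 0 by rewrite linear0.
have [||x0|[w [a2 xE]]] := Kt j (ker_val x) aj.
- by rewrite -valZ xj.
- by rewrite -valZ ax linear0.
- by left; apply: val_inj; rewrite [LHS]x0 [RHS]val0.
have [a1|a1] := eqVneq (a * e (s' j)) 0.
  by left; apply: val_inj; rewrite [LHS]xE [RHS]val0 scalerA a1 scale0r.
have dw : d (e (s' j) *: w) = 0.
  have [||//|[v [b2 vE]]] := Mt (s' j) (d (e (s' j) *: w)) a1.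
  - by rewrite -linearZ_LR scalerA (nak_eK nakB).
  - by rewrite -linearZ_LR -xE ker_val_eq0.
  have [b1|b1] := eqVneq (a * e (s' (s' j))) 0.
    by rewrite vE scalerA b1 scale0r.
  have := novB b1; rewrite !(nak_s'K nakB) a1 aj a2 eqxx.
  by move=> /(_ isT isT b2).
have wP : e (s' j) *: w \in ker_pred d by apply/eqP.
right; exists (Ker wP); split=> //; apply: val_inj.
by rewrite [LHS]xE [RHS]valZ valZ -[ker_val (Ker wP)]/(e (s' j) *: w)
  (scalerA (e (s' j))) (nak_eK nakB).
Qed.

(** The first syzygy lies over an arbitrary M, about whose torsion nothing is known. The second is
    the kernel of a map between free modules, so [kernel_torsion] applies to it. *)
Lemma quadratic_gldim M : pd_le M 2.
Proof.
pose aug : {linear {malg B[M]} -> M} := free_map (@id M).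
pose K1 := ker aug.
pose d0 : {linear {malg B[K1]} -> {malg B[M]}} := @ker_val _ _ _ aug \o free_map (@id K1).
apply: (@pd_le2 _ M _ _ _ aug d0 (@ker_val _ _ _ d0)).
- exact: free_projective.
- exact: free_projective.
- by apply: (torsion_projective nakB); apply: kernel_torsion; exact: free_torsion.
- exact: free_map_surj.
- move=> x; split=> [x0|[y ->]]; last by rewrite /= ker_val_eq0.
  have xP : x \in ker_pred aug by apply/eqP.
  have [y yE] := free_map_surj (Ker xP).
  by exists y; rewrite /= yE.
- move=> x; split=> [x0|[y ->]]; last exact: ker_val_eq0.
  have xP : x \in ker_pred d0 by apply/eqP.
  by exists (Ker xP).
- by move=> x x0; apply: val_inj; rewrite [LHS]x0 -[RHS]/(ker_val 0) linear0.
Qed.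
End Quadratic.

(** * Simple modules *)

Section SimpleModules.
Variables (F : fieldType) (B : algType F) (V : finType) (s s' : V -> V).
Variables (e : V -> B) (a : B) (N : nat).
Hypothesis nakB : nakayama s s' e a N.
Implicit Types (K M S : lmodType B) (i j : V) (l : nat).

Definition simple_at S j (x0 : S) : Prop :=
  [/\ x0 != 0, e j *: x0 = x0, a *: x0 = 0 & forall y, exists c : F, y = c%:A *: x0].

Lemma simple_at_span S j x b : e j *: x = x -> a *: x = 0 ->
  exists c : F, b *: x = c%:A *: x :> S.
Proof.
move=> xj ax.
have [|p E] := nak_right nakB (x := b * e j) (j := j).
  by rewrite -mulrA (nak_eK nakB).
have -> : b *: x = horner_alg a p *: x by rewrite -{1}xj scalerA E -scalerA xj.
exists p`_0; rewrite horner_algE scaler_suml.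
have aX l : a ^+ l.+1 *: x = 0 by rewrite exprSr -scalerA ax scaler0.
case sp: (size p) => [|m].
  by rewrite big_ord0 nth_default ?sp // scale0r scale0r.
rewrite big_ord_recl big1 ?addr0 => [|i _]; first by rewrite scaler_alg scale1r.
by rewrite scaler_alg aX scaler0.
Qed.

(** The submodule a S is 0, since S = a S would give S = a^N S = 0. Any nonzero e_j x then spans S
    over F. *)
Lemma simple_atP S : simple_module S -> exists j x0, @simple_at S j x0.
Proof.
case=> [[x /eqP x0] simS].
have aS0 (y : S) : a *: y = 0.
  have [||aS|aS] := simS (fun y => exists z, y = a *: z).
  - by exists 0; rewrite scaler0.
  - move=> b _ _ [z ->] [z' ->]; have [b' E] := nak_mulr_a nakB b.
    by exists (b' *: z + z'); rewrite scalerDr !scalerA E.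
  - by apply: aS; exists y.
  have aSX l (z : S) : exists z', z = a ^+ l *: z'.
    elim: l => [|l [z' ->]]; first by exists z; rewrite scale1r.
    by have [z'' ->] := aS z'; exists z''; rewrite scalerA -exprSr.
  by have [z ->] := aSX N y; rewrite (nak_nil nakB) scale0r scaler0.
have [j xj] : exists j, e j *: x != 0.
  apply/existsP; rewrite -negb_forall; apply: contra x0 => /forallP H.
  by rewrite (nak_decomp nakB x) big1 // => j _; apply/eqP; exact: H.
have ejx : e j *: (e j *: x) = e j *: x by rewrite scalerA (nak_eK nakB).
exists j, (e j *: x); split=> // y.
have [||U0|//] := simS (fun y => exists c : F, y = c%:A *: (e j *: x)).
- by exists 0; rewrite scale0r scale0r.
- move=> b _ _ [c ->] [c' ->].
  have [c'' E] := simple_at_span (b * c%:A) ejx (aS0 _).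
  by exists (c'' + c'); rewrite [b *: _]scalerA E !scalerDl.
- by case/eqP: xj; apply: U0; exists 1; rewrite !scale1r.
Qed.

(** A nonzero path of length l + m forbids the monomial a^l in x, so a^r splits off. This gives the
    kernels of the differentials between the B e_i. *)
Lemma path_kernel t m r x : x * e (iter m s t) = x -> x * (a ^+ m * e t) = 0 ->
  (forall l, (l < r)%N -> a ^+ (l + m) * e t != 0) ->
  exists z, z * e (iter (r + m) s t) = z /\ x = z * (a ^+ r * e (iter m s t)).
Proof.
move=> xm x0 rP; have [p xE] := nak_right nakB xm.
have /(horner_mul_eq0 (nak_nil nakB)) H : horner_alg a p * (a ^+ m * e t) = 0.
  rewrite -[RHS]x0 xE -mulrA; congr (_ * _).
  by rewrite (nak_commX nakB) mulrA (nak_eK nakB).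
have [|q qE] := @poly_mulXn F p r.
  move=> l /rP; apply: contraNeq => /H; rewrite mulrA -exprD => ->.
  by [].
exists (horner_alg a q * e (iter (r + m) s t)); split.
  by rewrite -mulrA (nak_eK nakB).
rewrite xE qE rmorphM /= rmorphXn /= horner_algX -!mulrA; congr (_ * _).
by rewrite (nak_commX nakB) iterD mulrA (nak_eK nakB).
Qed.

Lemma simple_kernel S j (x0 : S) r : simple_at j x0 -> r * e j = r -> r *: x0 = 0 ->
  exists z, z * e (s j) = z /\ r = z * (a * e j).
Proof.
case=> x00 ejx ax _ rj rx; have [p rE] := nak_right nakB rj.
have aX l : a ^+ l.+1 *: x0 = 0 by rewrite exprSr -scalerA ax scaler0.
(* With a nonzero constant coefficient, p(a) would divide a^0 = 1 and hence x0 would be 0. *)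
have p0 : p`_0 = 0.
  apply: contraNeq x00 => p00.
  have [q E] := nilpotent_horner_dvd (nak_nil nakB) p00.
  rewrite -(scale1r x0) -(expr0 a) E -scalerA -{1}ejx.
  by rewrite [horner_alg a p *: _]scalerA -rE rx scaler0.
have [|q qE] := @poly_mulXn F p 1; first by case.
exists (horner_alg a q * e (s j)); split; first by rewrite -mulrA (nak_eK nakB).
rewrite rE qE rmorphM /= horner_algX -!mulrA; congr (_ * _).
by rewrite (nak_comm nakB) mulrA (nak_eK nakB).
Qed.

(** This is the cokernel condition of [peirce_ext_line] when the last differential is an arrow; the
    coefficient c is the constant term of t. *)
Lemma vertex_line j t : e (s j) != 0 -> e (s j) * t = t ->
  exists! c : F, exists w, t - c *: e (s j) = a * e j * w.
Proof.
move=> ej0 tj; have [p tE] := nak_left nakB tj.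
exists p`_0; split=> [|c [w wE]].
  have [|q qE] := @poly_mulXn F (p - (p`_0)%:P) 1.
    by case=> // _; rewrite coefB coefC subrr.
  exists (horner_alg a q); rewrite tE (nak_comm nakB) -mulrA.
  have {2}-> : a = horner_alg a 'X by rewrite horner_algX.
  rewrite -rmorphM mulrC -[X in q * X]expr1 -qE rmorphB mulrBr /=; congr (_ - _).
  by rewrite horner_algC -scalerAr mulr1.
apply: contraNeq ej0 => ne.
have aX : a = horner_alg a 'X by rewrite horner_algX.
have [|q qE] := nak_left nakB (x := e j * w) (j := j); first by rewrite mulrA (nak_eK nakB).
have /(mul_horner_eq0 (nak_nil nakB)) H :
    e (s j) * horner_alg a (p - c%:P - 'X * q) = 0.
  rewrite !rmorphB rmorphM /= !mulrBr -tE -aX horner_algC -scalerAr mulr1 wE.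
  by rewrite [X in _ - X]mulrA -(nak_comm nakB) -!mulrA qE subrr.
have := H 0%N; rewrite mulr1 !coefB coefC coefXM subr0 /= subr_eq0 => -> //.
Qed.
End SimpleModules.

(** * Explicit resolutions of simples, of length 0, 1 and 2 *)

Section SimpleResolutions.
Variables (F : fieldType) (B : algType F) (V : finType) (s s' : V -> V).
Variables (e : V -> B) (a : B) (N : nat).
Hypothesis nakB : nakayama s s' e a N.
Variables (S : lmodType B) (j : V) (x0 : S).
Hypothesis simS : simple_at e a j x0.

Let x0j : e j *: x0 = x0. Proof. by case: simS. Qed.
Let ax0 : a *: x0 = 0. Proof. by case: simS. Qed.
Let x0_surj m : exists r, r *: x0 = m.
Proof. by case: simS => _ _ _ /(_ m) [c ->]; exists c%:A. Qed.

Lemma arrow_mulr i : a * e i * e i = a * e i.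
Proof. by rewrite -mulrA (nak_eK nakB). Qed.

Lemma arrow_mull i : e (s i) * (a * e i) = a * e i.
Proof. by rewrite (nak_comm nakB) mulrA (nak_eK nakB). Qed.

(** The default value 0 of [nth] supplies the vanishing terms beyond the listed ones. *)
Lemma simple_exact0 : a * e j = 0 -> peirce_exact (nth 0 [:: e j]) (nth 0 [::]) x0.
Proof.
move=> aj; split=> //.
- by case=> [|i]; rewrite /= ?(nak_eK nakB) // ?nth_nil ?mulr0.
- by move=> i; rewrite ?nth_nil ?mul0r.
- by move=> i; rewrite ?nth_nil ?mulr0.
- by rewrite scale0r.
- by move=> i; rewrite ?nth_nil ?mul0r.
- move=> r rj /(simple_kernel nakB simS rj) [z [_ ->]]; exists 0.
  by split; rewrite ?aj ?mulr0 ?mul0r.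
- by move=> i r; rewrite /= ?nth_nil ?mulr0 => <- _; exists 0; rewrite !mul0r.
Qed.

Definition right_regular_arrow i : Prop :=
  forall z, z * e (s i) = z -> z * (a * e i) = 0 -> z = 0.

Lemma simple_exact1 : right_regular_arrow j ->
  peirce_exact (nth 0 [:: e j; e (s j)]) (nth 0 [:: a * e j]) x0.
Proof.
move=> inj; split=> //.
- by case=> [|[|i]]; rewrite /= ?(nak_eK nakB) // ?nth_nil ?mulr0.
- by case=> [|i]; rewrite /= ?arrow_mulr // ?nth_nil ?mul0r.
- by case=> [|i]; rewrite /= ?arrow_mull // ?nth_nil ?mulr0.
- by rewrite /= -scalerA x0j ax0.
- by case=> [|i]; rewrite /= ?nth_nil ?mul0r.
- by move=> r rj /(simple_kernel nakB simS rj).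
- case=> [|i] r /=; first by move=> rj /(inj _ rj) ->; exists 0; rewrite !mul0r.
  by rewrite ?nth_nil ?mulr0 => <- _; exists 0; rewrite !mul0r.
Qed.

Lemma simple_exact2 : a * e j != 0 -> a ^+ 2 * e j = 0 -> right_regular_arrow (s j) ->
  peirce_exact (nth 0 [:: e j; e (s j); e (s (s j))])
    (nth 0 [:: a * e j; a * e (s j)]) x0.
Proof.
move=> aj a2 inj; split=> //.
- by case=> [|[|[|i]]]; rewrite /= ?(nak_eK nakB) // ?nth_nil ?mulr0.
- by case=> [|[|i]]; rewrite /= ?arrow_mulr // ?nth_nil ?mul0r.
- by case=> [|[|i]]; rewrite /= ?arrow_mull // ?nth_nil ?mulr0.
- by rewrite /= -scalerA x0j ax0.
- case=> [|[|i]] /=; rewrite ?nth_nil ?mul0r //.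
  by rewrite -mulrA arrow_mull mulrA -expr2.
- by move=> r rj /(simple_kernel nakB simS rj).
- case=> [|[|i]] r /=.
  + move=> rj r0.
    have [|z [zP zE]] := path_kernel nakB (t := j) (m := 1) (r := 1) (x := r) rj r0.
      by case=> // _; rewrite add0n expr1.
    by exists z.
  + by move=> rj /(inj _ rj) ->; exists 0; rewrite !mul0r.
  + by rewrite ?nth_nil ?mulr0 => <- _; exists 0; rewrite !mul0r.
Qed.
End SimpleResolutions.

Section Regularity.
Variables (F : fieldType) (B : algType F) (V : finType) (s s' : V -> V).
Variables (e : V -> B) (a : B) (N : nat).
Hypothesis nakB : nakayama s s' e a N.
Hypotheses (quadB : quadratic s e a) (novB : no_overlap s e a).

(** A nonzero path from s i must stay nonzero when preceded by the arrow at i: either those first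
    two arrows have a nonzero product, or the path is trivial. *)
Lemma quadratic_right_regular i : a * e i != 0 ->
  (a ^+ 2 * e i != 0) || (a * e (s i) == 0) -> right_regular_arrow s e a i.
Proof.
move=> ai H z zi z0; have [p zE] := nak_right nakB zi.
have /(horner_mul_eq0 (nak_nil nakB)) K : horner_alg a p * (a * e i) = 0.
  by rewrite -[RHS]z0 zE -[in RHS]mulrA (arrow_mull nakB).
rewrite zE; apply/(horner_mul_eq0 (nak_nil nakB)) => l pl.
apply: contra_eq (K l pl) => al; rewrite mulrA -exprSr.
case: l pl al => [|l] pl al; first by rewrite expr1.
case/orP: H => [a2|/eqP a1]; first exact: (quadratic_prepend nakB).
by case/eqP: al; rewrite exprSr -mulrA a1 mulr0.
Qed.

(** A zero relation ending in the arrow at j makes the preceding arrow an element of e_j B killed by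
    a, so that Hom(S, B) is nonzero. [no_overlap] excludes this when k = 2, and the last hypothesis
    when k = 1. *)
Lemma quadratic_regular (S : lmodType B) k : simple_module S -> pd_eq S k -> (0 < k <= 2)%N ->
  (k = 1%N -> forall i, a * e i != 0 -> a * e (s i) != 0 -> a ^+ 2 * e i != 0) ->
  k_regular S k.
Proof.
move=> Ssim pdS /andP[k0 k2] k1.
have [j [x0 simS]] := simple_atP nakB Ssim; have [pdle pdk] := pdS.
have aj : a * e j != 0.
  apply: contraTneq k0 => /(simple_exact0 nakB simS) ex; rewrite -leqNgt.
  by apply: pdk; apply: (peirce_pd_le ex); case=> // i _; rewrite /= ?nth_nil.
have esj0 i : a * e i != 0 -> e (s i) != 0.
  by apply: contraNneq => E; rewrite (nak_comm nakB) E mul0r.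
have line i t : a * e i != 0 -> e (s i) * t = t ->
    exists! c : F, exists w, t - c *: e (s i) = a * e i * w.
  by move=> ai; apply: (vertex_line nakB); exact: esj0.
have ext0 : (a * e (s' j) != 0 -> a ^+ 2 * e (s' j) != 0) ->
    forall t, e j * t = t -> a * e j * t = 0 -> t = 0.
  move=> H t tj; rewrite -mulrA tj => at0.
  have [tP|[b1 [b2 _]]] := left_torsion nakB quadB aj; first exact: tP.
  by have := H b1; rewrite b2 eqxx.
case: (boolP ((a ^+ 2 * e j == 0) && (a * e (s j) != 0))) => [/andP[/eqP a2 asj]|nrel].
  have k2' : k = 2.
    case: k {pdS pdle pdk} k0 k2 k1 => [|[|[|k]]] // _ _ /(_ erefl j aj asj).
    by rewrite a2 eqxx.
  have inj : right_regular_arrow s e a (s j).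
    apply: quadratic_right_regular => //.
    by have [_|assj] := eqVneq (a * e (s (s j))) 0; rewrite ?orbT // novB.
  have ex := simple_exact2 nakB simS aj a2 inj.
  rewrite {}k2' in pdS *; split=> // [[|[|i]] // _|].
  - apply: (peirce_ext0_vanish ex) => /=; apply: ext0 => b1.
    by apply/eqP => b2; have := novB b1; rewrite (nak_s'K nakB) aj asj a2 eqxx => /(_ isT isT b2).
  - apply: (peirce_ext_vanish ex) => /= t tj; rewrite -mulrA tj => at0.
    have [tP|[b1 [b2 tP]]] := left_torsion nakB quadB asj.
      by exists 0; rewrite mulr0; exact: tP.
    by have [w ->] := tP t tj at0; exists w; rewrite (nak_sK nakB) mulrA.
  - by apply: (peirce_ext_line ex) => //= t tj; exact: line.
have inj : right_regular_arrow s e a j.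
  by apply: quadratic_right_regular => //; move: nrel; rewrite negb_and negbK.
have ex := simple_exact1 nakB simS inj.
have k1' : k = 1%N.
  apply/eqP; rewrite eqn_leq k0 andbT; apply: pdk; apply: (peirce_pd_le ex).
  by case=> [|[|i]] // _; rewrite /= ?nth_nil.
rewrite {}k1' in pdS k1 *; split=> // [[|i] // _|].
- apply: (peirce_ext0_vanish ex) => /=; apply: ext0 => b1.
  by apply: k1; rewrite // (nak_s'K nakB).
- by apply: (peirce_ext_line ex) => //= t tj; exact: line.
Qed.
End Regularity.

(** * Simple modules from characters *)

Section CharacterModule.
Variables (F : fieldType) (B : algType F).

(** A separate name for F, indexed by chi, so that each character carries its own B-module
    structure. *)
Definition char_module (chi : {rmorphism B -> F}) : Type := F.

Section Structure.
Variable chi : {rmorphism B -> F}.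
HB.instance Definition _ := GRing.Zmodule.on (char_module chi).

Definition char_scale (b : B) (x : char_module chi) : char_module chi := chi b * x.

Fact char_scaleA b c x : char_scale b (char_scale c x) = char_scale (b * c) x.
Proof. by rewrite /char_scale rmorphM mulrA. Qed.
Fact char_scale1 : left_id 1 char_scale.
Proof. by move=> x; rewrite /char_scale rmorph1 mul1r. Qed.
Fact char_scaleDr : right_distributive char_scale +%R.
Proof. by move=> b x y; exact: mulrDr. Qed.
Fact char_scaleDl x : {morph char_scale^~ x : b c / b + c}.
Proof. by move=> b c; rewrite /char_scale rmorphD; exact: mulrDl. Qed.
HB.instance Definition _ := GRing.Zmodule_isLmodule.Build B (char_module chi)
  char_scaleA char_scale1 char_scaleDr char_scaleDl.
End Structure.

Variables (V : finType) (s s' : V -> V) (e : V -> B) (a : B) (N : nat).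
Hypothesis nakB : nakayama s s' e a N.

Lemma vertex_char_uniq j (c : F) w : e j != 0 -> c *: e j = a * w -> c = 0.
Proof.
move=> ej E; apply: contraNeq ej => c0.
have [|p pE] := nak_right nakB (x := w * e j) (j := j).
  by rewrite -mulrA (nak_eK nakB).
have /(horner_mul_eq0 (nak_nil nakB)) H : horner_alg a (c%:P - 'X * p) * e j = 0.
  rewrite rmorphB rmorphM /= horner_algX horner_algC mulrBl -scalerAl mul1r -mulrA -pE.
  by rewrite mulrA -E -scalerAl (nak_eK nakB) subrr.
by have := H 0%N; rewrite coefB coefC coefXM subr0 mul1r => ->.
Qed.

(** The character reads off the constant coefficient of x e_j, that is, its class modulo a B.
    Multiplicativity rests on B a lying in a B. *)
Lemma vertex_char j : e j != 0 -> exists chi : {rmorphism B -> F},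
  forall x c w, x * e j = c *: e j + a * w -> chi x = c.
Proof.
move=> ej.
have /choice [chi chiP] x : exists c : F, exists w, x * e j = c *: e j + a * w.
  have [|p pE] := nak_right nakB (x := x * e j) (j := j).
    by rewrite -mulrA (nak_eK nakB).
  have [|q qE] := @poly_mulXn F (p - (p`_0)%:P) 1.
    by case=> // _; rewrite coefB coefC subrr.
  exists p`_0, (horner_alg a q * e j).
  rewrite pE -[X in horner_alg a X](subrK (p`_0)%:P) qE mulrC rmorphD rmorphM /= horner_algX.
  by rewrite horner_algC mulrDl -scalerAl mul1r addrC mulrA.
have chiE x c w : x * e j = c *: e j + a * w -> chi x = c.
  have [w' ->] := chiP x => E; apply/eqP; rewrite -subr_eq0; apply/eqP.
  apply: (@vertex_char_uniq j _ (w - w') ej); rewrite scalerBl mulrBr.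
  by apply/eqP; rewrite subr_eq addrAC eq_sym subr_eq addrC -E addrC.
have chi_zmod : zmod_morphism chi.
  move=> x y; have [w E] := chiP x; have [w' E'] := chiP y.
  apply: (chiE _ _ (w - w')).
  by rewrite mulrBl E E' scalerBl mulrBr opprD addrACA.
have chi_mon : monoid_morphism chi.
  split; first by apply: (chiE _ _ 0); rewrite mul1r scale1r mulr0 addr0.
  move=> x y; have [w E] := chiP x; have [w' E'] := chiP y.
  have [x' Ex'] := nak_mulr_a nakB x.
  apply: (chiE _ _ (chi y *: w + x' * w')).
  rewrite -mulrA E' mulrDr -scalerAr E scalerDr scalerA [chi y * _]mulrC -addrA.
  by congr (_ + _); rewrite mulrDr scalerAr !mulrA Ex'.
pose chiM : {rmorphism B -> F} := HB.pack chi
  (GRing.isZmodMorphism.Build _ _ chi chi_zmod)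
  (GRing.isMonoidMorphism.Build _ _ chi chi_mon).
by exists chiM.
Qed.

Lemma simple_at_exists j : e j != 0 -> exists (S : lmodType B) (x0 : S),
  simple_module S /\ simple_at e a j x0.
Proof.
move=> ej; have [chi chiE] := vertex_char ej.
have chi_alg (c : F) : chi c%:A = c.
  by apply: (chiE _ _ 0); rewrite mulr0 addr0 mulr_algl.
have scaleE b (x : char_module chi) : b *: x = chi b * (x : F) by [].
have line (x y : char_module chi) : x != 0 -> exists c : F, y = c%:A *: x.
  by move=> x0; exists ((y : F) / (x : F)); rewrite scaleE chi_alg divfK.
exists (char_module chi), (1 : F); split.
  split; first by exists (1 : F); apply/eqP; exact: oner_neq0.
  move=> U U0 UP; have [[x Ux x0]|nx] := pselect (exists2 x, U x & x != 0).
    right=> y; have [c ->] := line x y x0.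
    by rewrite -[_ *: _]addr0; exact: UP.
  by left=> x Ux; apply/eqP; apply: contraT => x0; case: nx; exists x.
split; first exact: oner_neq0.
- rewrite scaleE (chiE _ 1 0) ?mul1r // scale1r mulr0 addr0; exact: (nak_eK nakB).
- by rewrite scaleE (chiE _ 0 (e j)) ?mul0r // scale0r add0r.
- by move=> y; apply: line; exact: oner_neq0.
Qed.
End CharacterModule.

(** * Necessary conditions from the syzygies of simples *)

Section ProjectiveDimensionOfSimples.
Variables (F : fieldType) (B : algType F) (V : finType) (s s' : V -> V).
Variables (e : V -> B) (a : B) (N : nat).
Hypothesis nakB : nakayama s s' e a N.
Variables (S : lmodType B) (j : V) (x0 : S).
Hypotheses (simS : simple_at e a j x0) (aj : a * e j != 0).

(** Fixing a nonzero path forces the constant coefficient of v to be 1, so a power of a that kills v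
    also kills the idempotent. *)
Lemma path_fix t m r v : v * e (iter m s t) = v -> a ^+ m * e t != 0 ->
  v * (a ^+ m * e t) = a ^+ m * e t -> a ^+ r * v = 0 -> a ^+ r * e (iter m s t) = 0.
Proof.
move=> vm am vE rv; have [p pE] := nak_right nakB vm.
have /(horner_mul_eq0 (nak_nil nakB)) H : horner_alg a ('X^m * (p - 1)) * e t = 0.
  rewrite mulrC rmorphM rmorphB rmorph1 rmorphXn /= horner_algX -mulrA mulrBl mul1r.
  apply/eqP; rewrite subr_eq0 -[X in _ == X]vE pE -[X in _ == X]mulrA; apply/eqP; congr (_ * _).
  by rewrite (nak_commX nakB) mulrA (nak_eK nakB).
have p0 : p`_0 = 1.
  apply/eqP; rewrite -subr_eq0; apply: contraNT am => p0; apply/eqP/H.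
  by rewrite coefXnM ltnn subnn coefB coef1.
have /(horner_mul_eq0 (nak_nil nakB)) K : horner_alg a ('X^r * p) * e (iter m s t) = 0.
  by rewrite rmorphM rmorphXn /= horner_algX -mulrA -pE.
by apply: K; rewrite coefXnM ltnn subnn p0 oner_neq0.
Qed.

Let aug : {linear peirce (e j) -> S} := peirce_gen x0.
Let d0 : {linear peirce (e (s j)) -> peirce (e j)} :=
  peirce_mul (arrow_mulr nakB j).

Let aug_surj y : exists x, aug x = y.
Proof.
case: simS => _ ejx _ /(_ y) [c ->].
have E : (c%:A * e j) * e j = c%:A * e j by rewrite -mulrA (nak_eK nakB).
by exists (Peirce E); rewrite /= /peirce_gen PeirceE -scalerA ejx.
Qed.

Let exact0 x : aug x = 0 <-> exists y, x = d0 y.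
Proof.
split=> [x00|[y ->]].
  have [z [zP zE]] := simple_kernel nakB simS (peirceP x) x00.
  by exists (Peirce zP); apply: peirce_inj; exact: zE.
case: simS => _ ejx ax _.
rewrite -[LHS]/((peirce_val y * (a * e j)) *: x0) -!scalerA ejx ax.
by rewrite scaler0.
Qed.

Let proj0 : projective (peirce (e j)).
Proof. exact/peirce_projective/(nak_eK nakB). Qed.
Let proj1 : projective (peirce (e (s j))).
Proof. exact/peirce_projective/(nak_eK nakB). Qed.

(** The first syzygy is generated by the arrow at j and covered by B e_(s j). If it is projective
    the cover splits, and powers of a killing the arrow kill e_(s j). *)
Lemma pd1_path r : pd_le S 1 -> a ^+ r.+1 * e j = 0 -> a ^+ r * e (s j) = 0.
Proof.
move=> [P P1] ar.
pose x := Peirce (arrow_mulr nakB j).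
have augx : aug x = 0.
  apply/exact0; exists (Peirce (nak_eK nakB (s j))); apply: peirce_inj.
  by rewrite -[RHS]/(e (s j) * (a * e j)) (arrow_mull nakB).
have [y [yE yu]] := syzygy1_split proj0 aug_surj exact0 (P1 2 isT) augx.
have yE' : peirce_val y * (a * e j) = a * e j := congr1 (@peirce_val _ _) yE.
apply: (path_fix (t := j) (m := 1) (v := peirce_val y)) => //.
  exact: peirceP.
rewrite -peirce_valZ yu ?peirce_val0 //; apply: peirce_inj.
by rewrite peirce_valZ peirce_val0 PeirceE mulrA -exprSr.
Qed.

Section SecondSyzygy.
Variable m : nat.
Hypotheses (am : a ^+ m * e j != 0) (am1 : a ^+ m.+1 * e j = 0)
  (am' : a ^+ m * e (s j) != 0).

Fact second_relation_mulr : a ^+ m * e (s j) * e (s j) = a ^+ m * e (s j).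
Proof. by rewrite -mulrA (nak_eK nakB). Qed.

Let k2 := iter m s (s j).
Let d1 : {linear peirce (e k2) -> peirce (e (s j))} :=
  peirce_mul second_relation_mulr.

Let relation_mull : e k2 * (a ^+ m * e (s j)) = a ^+ m * e (s j).
Proof. by rewrite (nak_commX nakB) mulrA (nak_eK nakB). Qed.

Let exact1 x : d0 x = 0 <-> exists y, x = d1 y.
Proof.
split=> [x00|[y ->]]; last first.
  apply: peirce_inj; rewrite peirce_val0.
  rewrite -[LHS]/(peirce_val y * (a ^+ m * e (s j)) * (a * e j)).
  by rewrite -!mulrA (arrow_mull nakB) [a ^+ m * _]mulrA -exprSr am1 mulr0.
have x00' : peirce_val x * (a ^+ 1 * e j) = 0.
  by have := congr1 (@peirce_val _ _) x00; rewrite peirce_val0.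
have [|z [zP zE]] := path_kernel nakB (t := j) (m := 1) (r := m) (peirceP x) x00'.
  by move=> l lm; rewrite addn1; exact: path_prefix am.
have zP' : z * e k2 = z by rewrite -{2}zP addn1 iterSr.
by exists (Peirce zP'); apply: peirce_inj; exact: zE.
Qed.

(** The same argument for the second syzygy, generated by the path of length m from s j and covered
    by B e_k2. *)
Lemma pd2_path l : pd_le S 2 -> a ^+ (l + m) * e (s j) = 0 -> a ^+ l * e k2 = 0.
Proof.
move=> [P P2] al.
pose x := Peirce second_relation_mulr.
have d0x : d0 x = 0.
  apply/exact1; exists (Peirce (nak_eK nakB k2)); apply: peirce_inj.
  by rewrite -[RHS]/(e k2 * (a ^+ m * e (s j))) relation_mull.
have [y [yE yu]] :=
  syzygy2_split proj0 proj1 aug_surj exact0 exact1 (P2 3 isT) d0x.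
have yE' : peirce_val y * (a ^+ m * e (s j)) = a ^+ m * e (s j) :=
  congr1 (@peirce_val _ _) yE.
apply: (path_fix (t := s j) (m := m) (v := peirce_val y)) => //.
  exact: peirceP.
rewrite -peirce_valZ yu ?peirce_val0 //; apply: peirce_inj.
by rewrite peirce_valZ peirce_val0 PeirceE mulrA -exprD.
Qed.

Let d1_inj : pd_le S 2 -> forall x, d1 x = 0 -> x = 0.
Proof.
move=> pd x x00; apply: peirce_inj; rewrite peirce_val0.
have E : peirce_val x * (a ^+ m * e (s j)) = 0.
  by have := congr1 (@peirce_val _ _) x00; rewrite peirce_val0.
have [p pE] := nak_right nakB (peirceP x).
rewrite pE; apply/(horner_mul_eq0 (nak_nil nakB)) => l pl; apply: pd2_path => //.
have /(horner_mul_eq0 (nak_nil nakB)) /(_ l pl) :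
    horner_alg a p * (a ^+ m * e (s j)) = 0.
  by rewrite -[RHS]E pE -[in RHS]mulrA relation_mull.
by rewrite mulrA -exprD.
Qed.

Lemma linear_scale_in (P : lmodType B) (f : {linear P -> B^o}) (c : F) :
  exists g : {linear P -> B^o}, forall x, g x = c%:A *: f x.
Proof.
have lin : linear (fun x => c%:A *: f x).
  by move=> b x y; rewrite linearP scalerDr scaler_in_comm.
pose g : {linear P -> B^o} := HB.pack (fun x => c%:A *: f x)
  (GRing.isLinear.Build _ _ _ _ _ lin).
by exists g.
Qed.

(* If m >= 2, the image of precomposition with d1 contains no nonzero combination
   of e_k2 and the arrow into k2, so Ext^2 is at least two-dimensional. *)
Lemma ext2_path : pd_le S 2 -> ext_dim S (B^o : lmodType B) 2 1 -> (m <= 1)%N.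
Proof.
move=> pd [P [z [zc zP]]]; rewrite leqNgt; apply/negP => m1.
have [psi [psi_d psi_cob]] :=
  ext2_transfer P proj0 proj1 aug_surj exact0 exact1 (B^o) (d1_inj pd).
pose rho (t : B) : {linear peirce (e k2) -> B^o} := peirce_gen (t : B^o).
pose comb (u v : F) : B := e k2 * horner_alg a (u%:P + v *: 'X).
have ek2 : e k2 != 0 by apply: contraNneq am' => E; rewrite -relation_mull E mul0r.
have ek2a : e k2 * a != 0.
  apply: contraNneq am' => E; rewrite -relation_mull -(prednK (ltnW m1)) exprS.
  by rewrite !mulrA E !mul0r.
have comb0 (u v : F) : coboundary (i := 2) (P := P) (fun x => rho (comb u v) (psi x)) ->
    u = 0 /\ v = 0.
  move=> /psi_cob [g gP].
  pose x := Peirce (nak_eK nakB k2).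
  have E : comb u v = e k2 * a ^+ m * (g (Peirce (nak_eK nakB (s j))) : B).
    have := gP x; rewrite (peirce_homE (nak_eK nakB (s j)) g).
    rewrite -[LHS]/(e k2 * (e k2 * horner_alg a (u%:P + v *: 'X))) mulrA (nak_eK nakB) => Ex.
    rewrite /comb Ex -[LHS]/((e k2 * (a ^+ m * e (s j))) * (g _ : B)).
    by rewrite relation_mull (nak_commX nakB).
  set t := (g _ : B) in E.
  have [|q qE] := nak_left nakB (x := e (s j) * t) (j := s j).
    by rewrite mulrA (nak_eK nakB).
  (* As m is at least 2, X^m q has no terms in degrees 0 and 1, so u and v appear there
     unchanged. *)
  have /(mul_horner_eq0 (nak_nil nakB)) H :
      e k2 * horner_alg a (u%:P + v *: 'X - 'X^m * q) = 0.
    rewrite rmorphB rmorphM rmorphXn /= horner_algX mulrBr -/(comb u v) E.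
    by rewrite [X in _ - X]mulrA -(nak_commX nakB) -!mulrA qE subrr.
  split; apply/eqP.
    apply: contraNT ek2 => u0; have := H 0%N; rewrite mulr1 => -> //.
    by rewrite coefB coefD coefC coefZ coefX mulr0 addr0 coefXnM (ltnW m1) subr0.
  apply: contraNT ek2a => v0; have := H 1%N; rewrite expr1 => -> //.
  by rewrite coefB coefD coefC coefZ coefX mulr1 add0r coefXnM m1 subr0.
pose f (u v : F) : {linear P 2 -> B^o} := rho (comb u v) \o psi.
have fc u v : cocycle (f u v) by move=> x; rewrite /= psi_d linear0.
have combE u v : comb u v = u *: comb 1 0 + v *: comb 0 1.
  have hornerZ (k : F) p : horner_alg a (k *: p) = k *: horner_alg a p.
    by rewrite linearZ /= mulr_algl.
  rewrite /comb !scalerAr -mulrDr -!hornerZ -rmorphD; congr (_ * horner_alg a _).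
  by rewrite !scale0r addr0 add0r scale1r alg_polyC.
have [c1 [[g1 g1P] _]] := zP _ (fc 1 0).
have [c2 [[g2 g2P] _]] := zP _ (fc 0 1).
have [g1' g1E] := linear_scale_in g1 (c2 ord0).
have [g2' g2E] := linear_scale_in g2 (- c1 ord0).
(* Both cocycles are multiples, by c1 and c2, of one basis class, so c2 times the first minus c1
   times the second is a coboundary. Hence c1 = c2 = 0, and then the first cocycle alone is a
   coboundary. *)
have [c20 c10] : c2 ord0 = 0 /\ - c1 ord0 = 0.
  apply: comb0; exists (g1' \+ g2') => x.
  have lin_id (k l : F) (X A1 A2 Z : B) : X * (l *: A1 + (- k) *: A2) =
      l%:A * (X * A1 - k%:A * Z) + (- k)%:A * (X * A2 - l%:A * Z).
    rewrite !mulr_algl mulrDr -!scalerAr !scalerBr !scalerA mulNr mulrC.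
    by rewrite addrACA -opprD -scalerDl subrr scale0r subr0.
  rewrite [RHS]/= g1E g2E -g1P -g2P !big_ord1 combE.
  exact: lin_id.
have [] : (1 : F) = 0 /\ (0 : F) = 0; last by move/eqP; rewrite oner_eq0.
apply: comb0; exists g1 => x.
by rewrite -g1P big_ord1 (_ : c1 ord0 = 0) ?scale0r ?scale0r ?subr0 //; apply/eqP; rewrite -oppr_eq0 c10.
Qed.
End SecondSyzygy.
End ProjectiveDimensionOfSimples.

(** * The criterion in terms of the Kupisch series *)

Section KupischCriterion.
Variables (F : fieldType) (A : algType F) (V : finType) (s s' : V -> V).
Variables (e : V -> A) (a : A) (N : nat) (c : V -> nat).
Hypothesis nakA : nakayama (B := A) s' s e a N.
Hypothesis cP : forall j l, (e j * a ^+ l != 0) = (l < c j)%N.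
Hypothesis c_gt0 : forall j, (0 < c j)%N.

Let nakC : nakayama (B := A^c) s s' e a N. Proof. exact: nakayama_converse. Qed.

Let cPc j l : ((a : A^c) ^+ l * (e j : A^c) != 0) = (l < c j)%N.
Proof. by rewrite -cP -[_ * (e j : A^c)]/(e j * _) converse_exp. Qed.

Let cPc1 j : ((a : A^c) * (e j : A^c) != 0) = (1 < c j)%N.
Proof. by rewrite -cPc expr1. Qed.

(** The bounds 2 <= c, here and in [kupisch_hills], restrict attention to vertices with a nonzero
    outgoing arrow; the artificial successor of the last vertex of the linear quiver therefore never
    counts. *)
Definition kupisch_bounce : Prop := forall j, (2 <= c j)%N -> (c j <= c (s j))%N -> c j = 2.

Definition kupisch_hills : Prop := forall j,
  c j = 2 -> c (s j) = 2 -> (2 <= c (s (s j)))%N -> False.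

Let c_shift j : (c j <= (c (s j)).+1)%N.
Proof.
rewrite leqNgt; apply/negP => H.
have : ((a : A^c) ^+ (c (s j)).+1 * (e j : A^c) != 0) by rewrite cPc.
rewrite -addn1 => /(path_shift nakC).
by rewrite cPc ltnn.
Qed.

(** A path of length at least 2 means c j > 2, where the bounce condition rules out c j <= c (s j).
    So c drops by exactly one, and the question moves on to s j. *)
Lemma kupisch_quadratic : kupisch_bounce -> quadratic (B := A^c) s e a.
Proof.
move=> cB j l l0; elim: l j l0 => // l IHl j _; rewrite !cPc.
case: l IHl => [|l] IHl; first by rewrite /=.
move=> cj; rewrite /= -iterS iterSr => c3.
have cjs : c j = (c (s j)).+1.
  have := c_shift j; rewrite leq_eqVlt ltnS => /orP[/eqP //|/(cB j (ltnW (leq_ltn_trans _ cj)))].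
  by move=> /(_ isT) cj2; rewrite cj2 in cj.
have := IHl (s j) isT; rewrite !cPc cjs; apply; last by rewrite /= in c3 *.
by rewrite cjs in cj.
Qed.

Lemma kupisch_no_overlap : kupisch_hills -> no_overlap (B := A^c) s e a.
Proof.
move=> cH j.
rewrite !cPc1 => c1 c2 c3 /eqP; rewrite -[_ == 0]negbK cPc -leqNgt => c1'.
rewrite cPc ltnNge; apply/negP => c2'.
by apply: (cH j) => //; apply/eqP; rewrite eqn_leq ?c1 ?c2 ?c1' ?c2'.
Qed.

(** In the converse ring a path starts where it used to end, so this is [quadratic_prepend] read
    backwards. *)
Lemma quadratic_dual : quadratic (B := A^c) s e a -> quadratic (B := A) s' e a.
Proof.
move=> qC j l l0.
pose i := iter l.+1 s' j.
have Ej : j = iter l.+1 s i by rewrite (nak_iterK nakA).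
have E1 : a ^+ l.+1 * e j = (a : A^c) ^+ l.+1 * (e i : A^c).
  by rewrite converse_exp -[RHS]/(e i * a ^+ l.+1) (nak_commXV nakA) -Ej.
have E2 : a ^+ l * e j = (a : A^c) ^+ l * (e (s i) : A^c).
  by rewrite converse_exp -[RHS]/(e (s i) * a ^+ l) (nak_commXV nakA) -iterSr -Ej.
have E3 : a ^+ 2 * e (iter l.-1 s' j) = (a : A^c) ^+ 2 * (e i : A^c).
  rewrite converse_exp -[RHS]/(e i * a ^+ 2) (nak_commXV nakA) /i.
  by rewrite -(prednK l0) !iterS !(nak_sK nakC, nak_s'K nakC).
by rewrite E1 E2 E3 => al a2; exact: (quadratic_prepend nakC).
Qed.

Lemma no_overlap_dual : no_overlap (B := A^c) s e a -> no_overlap (B := A) s' e a.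
Proof.
move=> nC j a1 a2 a3 a4.
pose i := s' (s' (s' j)).
have E1 k : a * e k = (a : A^c) * (e (s' k) : A^c).
  by rewrite -[RHS]/(e (s' k) * a) (nak_comm nakA).
have E2 k : a ^+ 2 * e k = (a : A^c) ^+ 2 * (e (s' (s' k)) : A^c).
  by rewrite converse_exp -[RHS]/(_ * a ^+ 2) (nak_commX nakA).
rewrite !E1 in a1 a2 a3; rewrite E2; rewrite E2 in a4.
have := nC _ a3; rewrite !(nak_s'K nakC) => /(_ a2 a1) H.
by apply/eqP => /H; rewrite a4 eqxx.
Qed.

Lemma simple_pd_gt1 (S : lmodType A^c) j (x0 : S) : simple_at (B := A^c) e a j x0 ->
  (2 <= c j)%N -> (c j <= c (s j))%N -> ~ pd_le S 1.
Proof.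
move=> simS c2 cs pd.
have aj : (a : A^c) * (e j : A^c) != 0 by rewrite cPc1.
have := pd1_path nakC simS aj (r := (c j).-1) pd.
rewrite prednK // => H; have : ((c j).-1 < c (s j))%N by rewrite prednK.
rewrite -cPc H ?eqxx //.
by apply/eqP; rewrite -[_ == 0]negbK cPc ltnn.
Qed.

Let vertex_neq0 j : (e j : A^c) != 0.
Proof. by have := c_gt0 j; rewrite -cPc mul1r. Qed.

Theorem kupisch_criterion :
  gldim_le A 2 /\ restricted_Gorenstein A <-> kupisch_bounce /\ kupisch_hills.
Proof.
split=> [[gl2 [k [[glk kmin] reg]]]|[cB cH]].
  have cB : kupisch_bounce.
    move=> j c2 cs; have [S [x0 [Ssim simS]]] := simple_at_exists nakC (vertex_neq0 j).
    have npd1 := simple_pd_gt1 simS c2 cs.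
    have k2 : k = 2.
      apply/eqP; rewrite eqn_leq (kmin _ gl2) ltnNge; apply/negP => k1.
      by apply: npd1; apply: pd_le_leq k1 (glk S).
    case: reg => [|[_ /(_ S Ssim)]]; rewrite {}k2 //.
    have pdS : pd_eq S 2.
      by split=> // i pdi; rewrite ltnNge; apply/negP => i1; apply: npd1; exact: pd_le_leq pdi.
    case/(_ pdS) => _ _ ext2.
    have := ext2_path nakC simS (m := (c j).-1) _ _ _ (gl2 S) ext2.
    rewrite !cPc prednK // => H; apply/eqP; rewrite eqn_leq c2 andbT.
    rewrite -(prednK (ltnW c2)) ltnS; apply: H => //.
    by apply/eqP; rewrite -[_ == 0]negbK cPc ltnn.
  split=> // j cj csj cssj.
  have [S [x0 [Ssim simS]]] := simple_at_exists nakC (vertex_neq0 j).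
  (* Here the second syzygy is covered by the projective at s (s j), and the bound 2 would force the
     arrow there to vanish. *)
  have := pd2_path nakC simS (m := 1) _ _ _ (l := 1) (gl2 S).
  have eq0 i l : (c i <= l)%N -> (a : A^c) ^+ l * (e i : A^c) = 0.
    by move=> H; apply/eqP; rewrite -[_ == 0]negbK cPc -leqNgt.
  rewrite !cPc cj csj => /(_ isT (eq0 j 2 _) isT (eq0 (s j) 2 _)).
  rewrite cj csj => /(_ isT isT) /eqP; rewrite -[_ == 0]negbK cPc.
  by rewrite cssj.
have qC := kupisch_quadratic cB; have nC := kupisch_no_overlap cH.
have qA := quadratic_dual qC; have nA := no_overlap_dual nC.
have gl2 : gldim_le A 2 by move=> M; exact: (quadratic_gldim nakC qC nC).
split=> //.
have exk : exists k, `[< gldim_le A k >] by exists 2; apply/asboolP.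
have [k /asboolP glk kmin] := ex_minnP exk.
have kmin' i : gldim_le A i -> (k <= i)%N by move=> gi; apply: kmin; apply/asboolP.
exists k; split=> //; case: (posnP k) => [->|k0]; [by left|right].
have k2 : (0 < k <= 2)%N by rewrite k0 kmin'.
(* A zero relation would give a simple whose first syzygy is not projective. *)
have norel : k = 1%N -> forall i, (a : A^c) * (e i : A^c) != 0 ->
    (a : A^c) * (e (s i) : A^c) != 0 -> (a : A^c) ^+ 2 * (e i : A^c) != 0.
  move=> k1 i ai; apply: contraNneq => a2.
  have [S [x0 [Ssim simS]]] := simple_at_exists nakC (vertex_neq0 i).
  have pdS : pd_le S 1 by have := glk S; rewrite k1.
  by have := pd1_path nakC simS ai (r := 1) pdS a2; rewrite expr1 => ->.
split=> S Ssim pdS; last exact: (quadratic_regular nakC qC nC).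
apply: (quadratic_regular nakA qA nA) => // k1 i.
have E1 j : a * e j = (a : A^c) * (e (s' j) : A^c).
  by rewrite -[RHS]/(e (s' j) * a) (nak_comm nakA).
have -> : a ^+ 2 * e i = (a : A^c) ^+ 2 * (e (s' (s' i)) : A^c).
  by rewrite converse_exp -[RHS]/(_ * a ^+ 2) (nak_commX nakA).
rewrite !E1 => a1 a2; apply: norel => //.
by rewrite (nak_s'K nakC).
Qed.
End KupischCriterion.

(** * Bound quiver presentations *)

Section Presentation.
Variables (F : fieldType) (Q : quiver) (A : falgType F) (pi : bound_quiver_algebra Q A).
Variables (s s' : vertex Q -> vertex Q).
Hypotheses (sK : cancel s s') (s'K : cancel s' s).
Hypothesis tgtE : forall al : arrow Q, qtgt al = s (qsrc al).
Hypothesis src_inj : injective (@qsrc Q).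

Let e := bq_idem pi.
Let word_sum : pathalg F Q := \sum_al pabasis F (parr al).
Definition arrow_sum : A := pi word_sum.
Let a := arrow_sum.

Let piM x y : pi (x * y) = pi x * pi y.
Proof. exact: (bq_mul pi).2. Qed.

Lemma pabasisM (p q : qpath Q) :
  pabasis F p * pabasis F q = if Defs.pcomp p q is Some r then pabasis F r else 0.
Proof. by rewrite [LHS]pamulUU mulr1; case: (Defs.pcomp p q). Qed.

Lemma pamono_scale (k : F) (p : qpath Q) : pamono k p = k *: pabasis F p.
Proof.
rewrite /pabasis !pamonoE; exact: monalgU_scale.
Qed.

Lemma bq_idemM i j : e i * e j = if i == j then e i else 0.
Proof.
rewrite /e /bq_idem -piM pabasisM ptriv_comp /pstart /=.
by case: eqP => [->|_] //; rewrite linear0.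
Qed.

Lemma bq_idem_sum : \sum_j e j = 1.
Proof. by rewrite -linear_sum; exact: (bq_mul pi).1. Qed.

Lemma idem_arrow j al : e j * pi (pabasis F (parr al)) =
  if qsrc al == j then pi (pabasis F (parr al)) else 0.
Proof.
rewrite /e /bq_idem -piM pabasisM ptriv_comp /pstart /= eq_sym.
by case: eqP => // _; rewrite linear0.
Qed.

Lemma arrow_idem j al : pi (pabasis F (parr al)) * e j =
  if qtgt al == j then pi (pabasis F (parr al)) else 0.
Proof.
rewrite /e /bq_idem -piM pabasisM comp_ptriv /pend /=.
by case: eqP => // _; rewrite linear0.
Qed.

Lemma idem_arrow_sum j : e j * a = \sum_(al | qsrc al == j) pi (pabasis F (parr al)).
Proof.
rewrite /a /arrow_sum /word_sum linear_sum mulr_sumr [RHS]big_mkcond /=.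
by apply: eq_bigr => al _; rewrite idem_arrow.
Qed.

Lemma arrow_sum_comm j : a * e (s j) = e j * a.
Proof.
rewrite idem_arrow_sum /a /arrow_sum /word_sum linear_sum mulr_suml [RHS]big_mkcond /=.
by apply: eq_bigr => al _; rewrite arrow_idem tgtE (can_eq sK).
Qed.

Lemma arrow_from_sum al : pi (pabasis F (parr al)) = e (qsrc al) * a.
Proof.
rewrite idem_arrow_sum (bigD1 al) //= big1 ?addr0 // => be /andP[/eqP /src_inj ->].
by rewrite eqxx.
Qed.

(** At most one arrow leaves each vertex, so a path is determined by its start and its length. *)
Lemma path_image (p : qpath Q) : pi (pabasis F p) = e (pstart p) * a ^+ size (pword p).
Proof.
case: p => [[v w] chw]; rewrite /pstart /pword /=.
elim: w v chw => [|al w IHw] v chw.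
  rewrite mulr1 /e /bq_idem; congr (pi (pabasis F _)).
  exact: val_inj.
have /andP[/eqP src_v ch'] : (qsrc al == v) && chain (qtgt al) w := chw.
have -> : pabasis F (QPath (qpath_val := (v, al :: w)) chw) =
    pabasis F (parr al) * pabasis F (QPath (qpath_val := (qtgt al, w)) ch').
  rewrite pabasisM; case: pcompP => [r _ sr _ wr|]; last by rewrite /pend /pstart /= eqxx.
  by congr (pabasis F _); apply: qpath_inj; rewrite ?sr ?wr /pstart /pword /= ?src_v.
rewrite piM IHw arrow_from_sum src_v tgtE src_v exprS.
rewrite -arrow_sum_comm -!mulrA [e _ * (e _ * _)]mulrA bq_idemM eqxx.
by rewrite mulrA arrow_sum_comm -mulrA.
Qed.

Let commX l j : a ^+ l * e (iter l s j) = e j * a ^+ l.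
Proof.
elim: l j => [|l IHl] j; first by rewrite mul1r mulr1.
by rewrite exprSr iterS -mulrA arrow_sum_comm mulrA IHl -mulrA.
Qed.

Lemma arrow_sum_span x : exists p : vertex Q -> {poly F},
  x = \sum_j horner_alg a (p j) * e j.
Proof.
have [y <-] := bq_surj pi x; elim/pathalg_ind: y => [|y z [p pE] [q qE]|k p].
- by exists (fun=> 0); rewrite linear0 big1 // => j _; rewrite rmorph0 mul0r.
- exists (fun j => p j + q j); rewrite linearD pE qE -big_split; apply: eq_bigr => j _.
  by rewrite /= rmorphD mulrDl.
set l := size (pword p); set i := iter l s (pstart p).
exists (fun j => if j == i then k *: 'X^l else 0).
rewrite (bigD1 i) //= big1 ?addr0 => [|j /negPf ->]; last by rewrite rmorph0 mul0r.
rewrite eqxx pamono_scale linearZ_LR path_image linearZ /= rmorphXn /= horner_algX.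
by rewrite mulr_algl -scalerAl commX.
Qed.

Lemma arrow_sum_nilpotent : exists N, a ^+ N = 0.
Proof.
have [m [_ Im _]] := bq_adm pi; exists m.
have -> : a ^+ m = pi (word_sum ^+ m).
  elim: m {Im} => [|m IHm]; first by rewrite !expr0 (bq_mul pi).1.
  by rewrite !exprS piM -IHm.
apply: Im; elim: m => [|m IHm] //; rewrite exprSr => I idI; apply.
exists (word_sum ^+ m), word_sum; split=> //.
move=> J [J0 JB JM] Jarr; rewrite /word_sum; apply: big_ind => // [x y Jx Jy|al _].
  by rewrite -[y]opprK -[- y]sub0r; apply: (JB) => //; exact: JB.
by apply: Jarr; exists al.
Qed.

Lemma presentation_nakayama : exists N, nakayama (B := A) s' s e a N.
Proof.
have [N aN] := arrow_sum_nilpotent; exists N; split=> //.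
- exact: bq_idem_sum.
- exact: bq_idemM.
- by move=> j; rewrite -arrow_sum_comm s'K.
- exact: arrow_sum_span.
Qed.

(** The nonzero e_v a^i form a basis of e_v A; their independence is the coefficientwise
    annihilation test. *)
Lemma kupischP v l : (e v * a ^+ l != 0) = (l < kupisch pi v)%N.
Proof.
have [N nakA] := presentation_nakayama.
have exm : exists m, e v * a ^+ m == 0 by exists N; rewrite (nak_nil nakA) mulr0.
case: (ex_minnP exm) => m /eqP am mmin.
have vanish k : (m <= k)%N -> e v * a ^+ k = 0.
  by move=> mk; rewrite -(subnKC mk) exprD mulrA am mul0r.
suff -> : kupisch pi v = m.
  apply/idP/idP => [|lm]; first by rewrite ltnNge; apply: contra => /vanish ->.
  by apply/negP => /mmin; rewrite leqNgt lm.
pose X := [tuple e v * a ^+ i | i < m].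
have Xi (i : 'I_m) : X`_i = e v * a ^+ i by rewrite -tnth_nth tnth_mktuple.
rewrite /kupisch.
suff /size_basis -> : basis_of (<[bq_idem pi v]> * {:A})%VS X by [].
apply/andP; split.
  rewrite eqEsubv; apply/andP; split.
    apply/span_subvP => _ /tnthP [i ->]; rewrite tnth_mktuple.
    by apply: memv_mul; [exact: memv_line | exact: memvf].
  apply/prodvP => _ y /vlineP [k ->] _.
  have [|p pE] := nak_left nakA (x := e v * y) (j := v); first by rewrite mulrA bq_idemM eqxx.
  rewrite -scalerAl -/e pE; apply: memvZ; rewrite horner_algE mulr_sumr.
  apply: memv_suml => i _; rewrite -scalerAr; apply: memvZ.
  have [im|/vanish ->] := ltnP i m; last exact: mem0v.
  by rewrite -(Xi (Ordinal im)); apply: memv_span; rewrite mem_nth // size_tuple.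
apply/freeP => k; under eq_bigr do rewrite Xi.
move=> E i; apply/eqP; apply: contraT => ki.
have /(mul_horner_eq0 (nak_nil nakA)) /(_ (val i)) :
    e v * horner_alg a (\sum_(i < m) k i *: 'X^i) = 0.
  rewrite rmorph_sum mulr_sumr -[RHS]E; apply: eq_bigr => l' _ /=.
  by rewrite linearZ /= rmorphXn /= horner_algX mulr_algl -scalerAr.
rewrite coef_sum (bigD1 i) //= big1 ?addr0 => [|l' l'i]; last first.
  by rewrite coefZ coefXn -val_eqE eq_sym in l'i *; rewrite (negPf l'i) mulr0.
rewrite coefZ coefXn eqxx mulr1 => /(_ ki) /eqP /mmin.
by rewrite leqNgt ltn_ord.
Qed.
End Presentation.

(** * Lattice paths *)

Section LatticePathPoints.
Variable On : point -> Prop.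

Definition height (z : point) : int := z.1 + z.2.

(** What finite and bi-infinite paths have in common: visited points increase in both coordinates,
    and no height between two visited ones is skipped. *)
Record lattice_points : Prop := LatticePoints {
  lp_mono : forall z w, On z -> On w -> height z <= height w -> z.1 <= w.1 /\ z.2 <= w.2;
  lp_between : forall z w h, On z -> On w -> height z <= h <= height w ->
    exists u, On u /\ height u = h }.

Hypothesis lpOn : lattice_points.

Definition vertical (k h : int) : Prop := On (k, h) /\ On (k + 1, h).

Lemma vertical_max k h y : vertical k h -> On (k, y) -> y <= h.
Proof.
move=> [_ Oh] Oy; rewrite leNgt; apply/negP => hy.
by have [] := lp_mono lpOn Oh Oy; rewrite /height /=; lia.
Qed.

Lemma vertical_min k h y : vertical k h -> On (k + 1, y) -> h <= y.
Proof.
move=> [Oh _] Oy; rewrite leNgt; apply/negP => hy.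
by have [] := lp_mono lpOn Oy Oh; rewrite /height /=; lia.
Qed.

Lemma vertical_uniq k h h' : vertical k h -> vertical k h' -> h = h'.
Proof.
move=> vh vh'; apply/eqP; rewrite eq_le.
by rewrite (vertical_max vh' vh.1) (vertical_max vh vh'.1).
Qed.

Lemma column_between x y1 y2 y : On (x, y1) -> On (x, y2) -> y1 <= y <= y2 -> On (x, y).
Proof.
move=> O1 O2 yy; have [|u [Ou hu]] := lp_between lpOn (h := x + y) O1 O2.
  by rewrite /height /=; lia.
suff -> : (x, y) = u by [].
have [|u1 _] := lp_mono lpOn O1 Ou; first by rewrite hu /height /=; lia.
have [|u2 _] := lp_mono lpOn Ou O2; first by rewrite hu /height /=; lia.
move: u1 u2 hu; case: u {Ou} => ux uy; rewrite /height /= => u1 u2 hu.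
by congr (_, _); lia.
Qed.
End LatticePathPoints.

Lemma step_height z w : step z w -> height w = height z + 1.
Proof. by case/orP => /eqP ->; rewrite /height /=; lia. Qed.

Lemma step_mono z w : step z w -> z.1 <= w.1 /\ z.2 <= w.2.
Proof. by case/orP => /eqP -> /=; lia. Qed.

Section DyckPath.
Variables (N : nat) (D : seq point).
Hypothesis dyckD : dyck_path N D.

Let z0 : point := (0, 0).

Lemma path_height z s i : path step z s -> (i <= size s)%N ->
  height (nth z0 (z :: s) i) = height z + i%:Z.
Proof.
elim: s z i => [|w s IHs] z [|i] //=; rewrite ?addr0 //.
by move=> /andP[/step_height zw /IHs H] /H ->; rewrite zw; lia.
Qed.

Lemma dyck_nth_height i : (i < size D)%N -> height (nth z0 D i) = i%:Z.
Proof.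
by case: dyckD => s [-> ps _ _]; rewrite /= ltnS => /(path_height ps) ->; rewrite add0r.
Qed.

Lemma dyck_height (z : point) : z \in D -> exists2 i, (i < size D)%N & z = nth z0 D i /\ height z = i%:Z.
Proof.
move=> zD; exists (index z D); first by rewrite index_mem.
by rewrite -[X in height X](nth_index z0 zD) dyck_nth_height ?index_mem ?nth_index.
Qed.

Lemma dyck_points : lattice_points (fun z => z \in D).
Proof.
pose R : rel point := fun z w => (z.1 <= w.1) && (z.2 <= w.2).
have Rtr : transitive R.
  by move=> y x z /andP[? ?] /andP[? ?]; apply/andP; split; apply: le_trans; eassumption.
have Rrefl : reflexive R by move=> z; apply/andP; split; exact: lexx.
have srt : sorted R D.
  case: dyckD => s [-> ps _ _] /=; apply: sub_path ps => z w /step_mono [? ?].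
  exact/andP.
split=> [z w /dyck_height [i iD [-> hi]] /dyck_height [j jD [-> hj]]|z w h zD wD].
  rewrite dyck_nth_height // dyck_nth_height // lez_nat => ij.
  by have /andP[] := sorted_leq_nth Rtr Rrefl z0 srt i j iD jD ij.
have [i iD [_ ->]] := dyck_height zD; have [j jD [_ ->]] := dyck_height wD.
case: h => // k /andP[_ kj].
have kD : (k < size D)%N by apply: leq_ltn_trans jD; rewrite -lez_nat.
by exists (nth z0 D k); rewrite mem_nth // dyck_nth_height.
Qed.

(** The path has one point at each height, so visited points of consecutive heights are visited
    consecutively. *)
Lemma dyck_triP a b c : height b = height a + 1 -> height c = height a + 2 ->
  dyck_tri D a b c <-> [/\ a \in D, b \in D & c \in D].
Proof.
move=> hb hc; split=> [/mem_infix H|[aD bD cD]].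
  by split; apply: H; rewrite !inE eqxx ?orbT.
have [i iD [aE ha]] := dyck_height aD; have [j jD [bE hj]] := dyck_height bD.
have [k kD [cE hk]] := dyck_height cD.
have jE : j = i.+1 by lia.
have kE : k = i.+2 by lia.
rewrite jE kE in jD kD bE cE.
apply/infixP; exists (take i D), (drop i.+3 D).
by rewrite aE bE cE -[LHS](cat_take_drop i) (drop_nth z0) // (drop_nth z0 jD) (drop_nth z0 kD).
Qed.

Lemma dyck_origin : z0 \in D.
Proof. by case: dyckD => s [-> _ _ _]; rewrite inE eqxx. Qed.

Lemma dyck_end : (N%:Z, N%:Z) \in D.
Proof. by case: dyckD => s [-> _ <- _]; rewrite mem_last. Qed.

Lemma dyck_bounds (z : point) : z \in D -> [/\ 0 <= z.1, z.1 <= z.2 & z.2 <= N%:Z].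
Proof.
move=> zD; have above : z.1 <= z.2 by case: dyckD => s [_ _ _]; apply.
have [i _ [_ hi]] := dyck_height zD.
have [|z1 _] := lp_mono dyck_points dyck_origin zD; first by rewrite hi.
split=> //; rewrite leNgt; apply/negP => Nz.
have [hz|hz] := lerP (height z) (height (N%:Z, N%:Z)).
  by have [_] := lp_mono dyck_points zD dyck_end hz; rewrite /= leNgt Nz.
(* The path has 2N + 1 points, so no height exceeds 2N. *)
case: dyckD => s [DE ps sl _]; have szD : size D = (2 * N).+1.
  have := path_height ps (leqnn (size s)); rewrite DE /= (last_nth z0) in sl *.
  by rewrite sl /height /=; lia.
have [j jD [_ hj]] := dyck_height zD.
by move: hz; rewrite hj /height /=; lia.
Qed.

Variable c : nat -> nat.
Hypothesis areaD : forall i, (i <= N)%N -> dyck_area D i%:Z (c i)%:Z.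

Lemma dyck_area_point i : (i <= N)%N -> (i%:Z, i%:Z + (c i)%:Z - 1) \in D.
Proof.
move=> /areaD [h [hD _ cE]]; rewrite [X in (_, X)](_ : _ = h) //.
by rewrite cE; lia.
Qed.

Lemma dyck_area_max i y : (i <= N)%N -> (i%:Z, y) \in D -> y <= i%:Z + (c i)%:Z - 1.
Proof.
move=> /areaD [h [hD hmax cE]] /hmax yh; rewrite cE; lia.
Qed.

(** The point at the next height cannot lie in column i, where the area already gives the top, so
    the step out of that top is vertical. *)
Lemma dyck_vertical i : (i < N)%N ->
  vertical (fun z => z \in D) i%:Z (i%:Z + (c i)%:Z - 1).
Proof.
move=> iN; have pD := dyck_area_point (ltnW iN); split=> //.
set h := i%:Z + _ - 1 in pD *.
have [_ _ /= hN] := dyck_bounds pD.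
have [|u [uD hu]] := lp_between dyck_points (h := i%:Z + h + 1) pD dyck_end.
  by rewrite /height /=; lia.
have [|u1 u2] := lp_mono dyck_points pD uD; first by rewrite hu /height /=; lia.
suff -> : (i%:Z + 1, h) = u by [].
case: u uD hu u1 u2 => ux uy uD; rewrite /height /= => hu u1 u2.
have [ux_eq|ux_ne] := eqVneq ux i%:Z; last by congr (_, _); lia.
by rewrite ux_eq in uD hu; have := dyck_area_max (ltnW iN) uD; rewrite -/h; lia.
Qed.

Lemma dyck_area_ge2 i : (i < N)%N -> (2 <= c i)%N.
Proof.
by move=> /dyck_vertical [_ /dyck_bounds [_ /= H _]]; lia.
Qed.

Lemma dyck_area_last : c N = 1%N.
Proof.
have [_ /= H1 H2] := dyck_bounds (dyck_area_point (leqnn N)).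
by lia.
Qed.

(** Column i + 1 rises above the top of column i exactly when c_i <= c_(i+1). The resulting valley
    (i + 1, i + c_i - 1) is on the diagonal iff c_i = 2. *)
Lemma dyck_bounceP : bounce (dyck_tri D) <->
  forall i, (i < N)%N -> (c i <= c i.+1)%N -> c i = 2.
Proof.
split=> [bD i iN cc|cB x y].
  have [V1 V2] := dyck_vertical iN.
  have V3 : (i%:Z + 1, i.+1%:Z + (c i.+1)%:Z - 1) \in D.
    by have := dyck_area_point iN; rewrite (_ : i.+1%:Z = i%:Z + 1) //; lia.
  suff /bD : valley (dyck_tri D) (i%:Z + 1) (i%:Z + (c i)%:Z - 1) by lia.
  apply/dyck_triP; rewrite /height /=; [lia|lia|].
  split=> //; first by rewrite (_ : i%:Z + 1 - 1 = i%:Z) //; lia.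
  by apply: (column_between dyck_points V2 V3); lia.
rewrite /valley => /dyck_triP []; rewrite /height /=; [lia|lia|].
move=> P1 P2 P3; have [/= x1 _ _] := dyck_bounds P1; have [_ /= xy yN] := dyck_bounds P3.
case: x x1 xy P1 P2 P3 => [[|i]|//]; [lia|] => x1 xy P1 P2 P3.
have iN : (i < N)%N by lia.
have E1 : i.+1%:Z - 1 = i%:Z by lia.
have E2 : i.+1%:Z = i%:Z + 1 by lia.
have yE : y = i%:Z + (c i)%:Z - 1.
  apply: (vertical_uniq dyck_points) (dyck_vertical iN).
  by split; rewrite -?E2 // -E1.
have := dyck_area_max iN P3; have := cB i iN; lia.
Qed.

(** For q = i + 1, the path meets (q, q) iff c_i = 2, and from there it makes a 1-hill iff also
    c_(i+1) = 2. The bound on i says that the hill ends before (N, N). *)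
Lemma dyck_hillsP :
  (forall q, hill1 (dyck_tri D) q -> q = 0 \/ q + 1 = N%:Z) <->
  forall i, (i.+2 < N)%N -> c i = 2 -> c i.+1 = 2 -> False.
Proof.
split=> [hD i iN ci ci1|cH q].
  have [_ V2] := dyck_vertical (ltnW (ltnW iN)).
  have [V3 V4] := dyck_vertical (ltnW iN).
  have [||] := hD i.+1%:Z; [|lia|lia].
  apply/dyck_triP; rewrite /height /=; [lia|lia|split].
  - rewrite [X in X \in D](_ : _ = (i%:Z + 1, i%:Z + (c i)%:Z - 1)) //.
    by congr (_, _); lia.
  - rewrite [X in X \in D](_ : _ = (i.+1%:Z, i.+1%:Z + (c i.+1)%:Z - 1)) //.
    by congr (_, _); lia.
  - rewrite [X in X \in D](_ : _ = (i.+1%:Z + 1, i.+1%:Z + (c i.+1)%:Z - 1)) //.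
    by congr (_, _); lia.
rewrite /hill1 => /dyck_triP []; rewrite /height /=; [lia|lia|].
move=> P1 P2 P3; have [/= q0 _ _] := dyck_bounds P1; have [_ _ /= qN] := dyck_bounds P3.
case: q q0 qN P1 P2 P3 => [[|i]|//]; first by left.
move=> _ qN P1 P2 P3; right.
have iN : (i.+1 < N)%N by lia.
have [iN'|iN'] := eqVneq i.+2 N; first by lia.
exfalso; apply: (cH i); first by lia.
  have := vertical_min dyck_points (dyck_vertical (ltnW iN)) (y := i.+1%:Z).
  rewrite (_ : i%:Z + 1 = i.+1%:Z); last by lia.
  by move=> /(_ P1); have := dyck_area_ge2 (ltnW iN); lia.
have := vertical_uniq dyck_points (dyck_vertical iN) (conj P2 P3); lia.
Qed.
End DyckPath.

Section PeriodicPath.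
Variable D : int -> point.
Hypothesis stepD : forall t, step (D t) (D (t + 1)).

Let On (z : point) : Prop := exists t, D t = z.

Lemma periodic_height_nat t (m : nat) : height (D (t + m%:Z)) = height (D t) + m%:Z.
Proof.
elim: m => [|m IHm]; first by rewrite !addr0.
by rewrite (_ : t + m.+1%:Z = t + m%:Z + 1) ?(step_height (stepD _)) ?IHm; lia.
Qed.

Lemma periodic_height t u : height (D u) = height (D t) + (u - t).
Proof.
have [tu|ut] := lerP t u.
  by have := periodic_height_nat t `|u - t|%N; rewrite gez0_abs ?subr_ge0 // addrCA subrr addr0.
have := periodic_height_nat u `|t - u|%N.
by rewrite gez0_abs ?subr_ge0 1?ltW // addrCA subrr addr0; lia.
Qed.

Lemma periodic_mono t u : t <= u -> (D t).1 <= (D u).1 /\ (D t).2 <= (D u).2.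
Proof.
move=> tu; have -> : u = t + `|u - t|%N%:Z by rewrite gez0_abs ?subr_ge0 // addrCA subrr addr0.
elim: `|u - t|%N => [|m [IH1 IH2]]; first by rewrite addr0.
have := step_mono (stepD (t + m%:Z)).
by rewrite (_ : t + m.+1%:Z = t + m%:Z + 1); [move=> []; lia|lia].
Qed.

Lemma periodic_points : lattice_points On.
Proof.
split=> [_ _ [t <-] [u <-]|_ _ h [t <-] [u <-] H].
  by rewrite (periodic_height t u) => H; apply: periodic_mono; lia.
exists (D (t + (h - height (D t)))); split; first by eexists.
by rewrite (periodic_height t); lia.
Qed.

Lemma periodic_time t z k : D t = z -> On k -> D (t + (height k - height z)) = k.
Proof.
by move=> <- [u <-]; congr D; rewrite (periodic_height t u); lia.
Qed.

Lemma bi_triP a b c : height b = height a + 1 -> height c = height a + 2 ->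
  bi_tri D a b c <-> [/\ On a, On b & On c].
Proof.
move=> hb hc; split=> [[t [ta tb tc]]|[[t ta] Ob Oc]].
  by split; eexists; eassumption.
exists t; split=> //; [rewrite -[RHS](periodic_time ta Ob)|rewrite -[RHS](periodic_time ta Oc)].
  by rewrite hb addrAC subrr add0r.
by rewrite hc addrAC subrr add0r.
Qed.

Lemma bi_verticalP k h : bi_vertical D k h -> vertical On k h.
Proof. by move=> [t [t1 t2]]; split; eexists; eassumption. Qed.

Variable c : int -> nat.
Hypotheses (c_vertical : forall k, vertical On k (k + (c k)%:Z - 1))
  (c_ge2 : forall k, (2 <= c k)%N).

Lemma periodic_bounceP : bounce (bi_tri D) <->
  forall k, (c k <= c (k + 1))%N -> c k = 2.
Proof.
split=> [bD k cc|cB x y].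
  have [V1 V2] := c_vertical k; have [V3 _] := c_vertical (k + 1).
  suff /bD : valley (bi_tri D) (k + 1) (k + (c k)%:Z - 1) by lia.
  apply/bi_triP; rewrite /height /=; [lia|lia|].
  split=> //; first by rewrite addrK.
  by apply: (column_between periodic_points V2 V3); lia.
rewrite /valley => /bi_triP []; rewrite /height /=; [lia|lia|] => P1 P2 P3.
have yE : y = (x - 1) + (c (x - 1))%:Z - 1.
  apply: (vertical_uniq periodic_points) (c_vertical _).
  by split; rewrite ?subrK.
have := vertical_max periodic_points (c_vertical x) P3.
by have := cB (x - 1); rewrite subrK; lia.
Qed.

Lemma periodic_hillsP : (forall q, ~ hill1 (bi_tri D) q) <->
  forall k, c k = 2 -> c (k + 1) = 2 -> False.
Proof.
split=> [hD k ck ck1|cH q].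
  have [_ V2] := c_vertical k; have [V3 V4] := c_vertical (k + 1).
  apply: (hD (k + 1)); apply/bi_triP; rewrite /height /=; [lia|lia|split].
  - by rewrite [X in On X](_ : _ = (k + 1, k + (c k)%:Z - 1)) //; congr (_, _); lia.
  - rewrite [X in On X](_ : _ = (k + 1, k + 1 + (c (k + 1))%:Z - 1)) //.
    by congr (_, _); lia.
  - rewrite [X in On X](_ : _ = (k + 1 + 1, k + 1 + (c (k + 1))%:Z - 1)) //.
    by congr (_, _); lia.
rewrite /hill1 => /bi_triP []; rewrite /height /=; [lia|lia|] => P1 P2 P3.
apply: (cH (q - 1)).
  have := vertical_min periodic_points (c_vertical (q - 1)) (y := q).
  by rewrite subrK => /(_ P1); have := c_ge2 (q - 1); lia.
rewrite subrK.
have := vertical_uniq periodic_points (c_vertical q) (conj P2 P3); lia.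
Qed.
End PeriodicPath.

(** * Indexing by residues and the two quivers *)

Section IntegerIndex.
Variables (n : nat) (n_gt0 : (0 < n)%N).

Fact int_ord_subproof (k : int) : (`|(k %% n%:Z)%Z| < n)%N.
Proof.
have n0 : n%:Z != 0 by lia.
have := modz_ge0 k n0; have := ltz_mod k n0; lia.
Qed.

Definition int_ord (k : int) : 'I_n := Ordinal (int_ord_subproof k).

Lemma int_ordE k : ((int_ord k : nat)%:Z = (k %% n%:Z)%Z)%R.
Proof. by rewrite /= gez0_abs // modz_ge0 //; lia. Qed.

Lemma int_ord_nat (i : 'I_n) : int_ord i%:Z = i.
Proof. by apply: val_inj; rewrite /= modz_nat modn_small. Qed.

Lemma int_ordS k : int_ord (k + 1) = ordS (int_ord k).
Proof.
apply: val_inj; apply/eqP; rewrite -eqz_nat int_ordE -modzDml -(int_ordE k).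
by rewrite -[1]/(Posz 1) -PoszD addn1 modz_nat.
Qed.
End IntegerIndex.

Lemma linear_quiver_tgt n (al : arrow (linear_quiver n)) :
  qtgt al = ordS (qsrc al) :> 'I_n.
Proof.
by apply: val_inj; rewrite /= modn_small // linear_tgt_subproof.
Qed.

Lemma linear_quiver_src_inj n : injective (@qsrc (linear_quiver n)).
Proof. by move=> x y /(congr1 val) /= E; apply: val_inj. Qed.

Theorem theorem4p5 (F : fieldType) (n : nat) (n_gt0 : (0 < n)%N) (A : falgType F) :
  (forall (pi : LNakayama n A) (D : seq point),
     dyck_path n.-1 D ->
     (forall i : 'I_n, dyck_area D i%:Z (kupisch pi i)%:Z) ->
     (gldim_le A 2 /\ restricted_Gorenstein A
      <->
      bounce (dyck_tri D) /\
      forall q : int, hill1 (dyck_tri D) q -> q = 0 \/ q + 1 = (n.-1)%:Z))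
  /\
  (forall (pi : CNakayama n A) (D : int -> point),
     periodic_dyck_path n D ->
     (forall (i : 'I_n) (m : int),
        periodic_area D (i%:Z + m * n%:Z) (kupisch pi i)%:Z) ->
     (gldim_le A 2 /\ restricted_Gorenstein A
      <->
      bounce (bi_tri D) /\ forall q : int, ~ hill1 (bi_tri D) q)).
Proof.
split=> pi D dyckD areaD.
  case: n n_gt0 pi D dyckD areaD => // N _ pi D dyckD areaD; rewrite /= in dyckD *.
  pose kup (j : 'I_N.+1) : nat := kupisch pi j.
  pose c (i : nat) : nat := kup (inord i).
  have area i : (i <= N)%N -> dyck_area D i%:Z (c i)%:Z.
    by move=> iN; have := areaD (inord i); rewrite inordK.
  have kupE j : kup j = c j by rewrite /c inord_val.
  have c_last := dyck_area_last dyckD area.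
  have c_ge2 := dyck_area_ge2 dyckD area.
  (* The last vertex has c = 1, so 2 <= c keeps the cyclic successor from wrapping around. *)
  have ltN (j : 'I_N.+1) : (2 <= kup j)%N -> (j < N)%N.
    rewrite kupE => cj; rewrite ltn_neqAle -ltnS ltn_ord andbT.
    by apply: contraTneq cj => ->; rewrite c_last.
  have ordSI i : (i < N)%N -> ordS (inord i : 'I_N.+1) = inord i.+1.
    by move=> iN; apply: val_inj; rewrite /= !inordK ?modn_small ?ltnS // ltnW.
  have kupS (j : 'I_N.+1) : (j < N)%N -> kup (ordS j) = c j.+1.
    by move=> jN; rewrite /c -ordSI // inord_val.
  have [M nakA] := presentation_nakayama pi (@ordSK N.+1) (@ord_predK N.+1)
    (@linear_quiver_tgt N.+1) (@linear_quiver_src_inj N.+1).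
  have kupP := kupischP pi (@ordSK N.+1) (@ord_predK N.+1)
    (@linear_quiver_tgt N.+1) (@linear_quiver_src_inj N.+1).
  have kup_gt0 (j : 'I_N.+1) : (0 < kup j)%N.
    rewrite kupE; have := ltn_ord j; rewrite ltnS leq_eqVlt => /orP[/eqP ->|/c_ge2 /ltnW //].
    by rewrite c_last.
  rewrite (kupisch_criterion nakA kupP kup_gt0).
  rewrite (dyck_bounceP dyckD area) (dyck_hillsP dyckD area).
  split=> -[cB cH]; split.
  - by move=> i iN cc; apply: (cB (inord i)); rewrite ?ordSI //; exact: c_ge2.
  - move=> i iN ci ci1; apply: (cH (inord i)) => //; rewrite ?ordSI //; try lia.
    exact: c_ge2.
  - move=> j cj; have jN := ltN j cj.
    by rewrite -/(kup j) -/(kup (ordS j)) kupS // kupE; exact: cB.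
  - move=> j cj csj cssj.
    have jN : (j < N)%N by apply: ltN; rewrite /kup cj.
    have sjE : ordS j = j.+1 :> nat by rewrite /= modn_small.
    have sjN : (j.+1 < N)%N by rewrite -sjE; apply: ltN; rewrite /kup csj.
    have ssjE : ordS (ordS j) = j.+2 :> nat by rewrite /= !modn_small.
    apply: (cH j); first by rewrite -ssjE; exact: ltN.
      by rewrite -kupE.
    by rewrite -kupS.
pose kup (j : 'I_n) : nat := kupisch pi j.
pose c (k : int) : nat := kup (int_ord n_gt0 k).
have [stepD _ vertD] := dyckD.
have c_vert k : bi_vertical D k (k + (c k)%:Z - 1).
  (* The quotient of k by n selects the translate of the area hypothesis located at x = k. *)
  have [h [hv hE]] := areaD (int_ord n_gt0 k) (k %/ n%:Z)%Z.
  have kE : (int_ord n_gt0 k : nat)%:Z + (k %/ n%:Z)%Z * n%:Z = k.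
    by rewrite int_ordE addrC -divz_eq.
  rewrite kE in hv hE; rewrite (_ : k + (c k)%:Z - 1 = h) //.
  by rewrite /c hE; lia.
have c_ge2 k : (2 <= c k)%N.
  by have [h [[_ hu] kh]] := vertD k; have := hu _ (c_vert k); lia.
have c_vertical k := bi_verticalP (c_vert k).
have kupE (j : 'I_n) : kup j = c j%:Z by rewrite /c int_ord_nat.
have cS k : c (k + 1) = kup (ordS (int_ord n_gt0 k)) by rewrite /c int_ordS.
have [M nakA] := presentation_nakayama pi (@ordSK n) (@ord_predK n)
  (fun=> erefl) (@inj_id _).
have kupP := kupischP pi (@ordSK n) (@ord_predK n) (fun=> erefl) (@inj_id _).
have kup_gt0 j : (0 < kup j)%N by rewrite kupE ltnW.
rewrite (kupisch_criterion nakA kupP kup_gt0).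
rewrite (periodic_bounceP stepD c_vertical) (periodic_hillsP stepD c_vertical c_ge2).
split=> -[cB cH]; split.
- by move=> k; rewrite cS; apply: cB; exact: c_ge2.
- move=> k ck; rewrite cS => csk; apply: (cH _ ck csk).
  by rewrite -/(kup _) kupE.
- by move=> j _; have := cB j%:Z; rewrite cS int_ord_nat -kupE; exact.
- move=> j cj csj _; apply: (cH j%:Z).
    by rewrite -kupE.
  by rewrite cS int_ord_nat.
Qed.
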